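(* Let $T>0$, let $A,C\in C([0,T];\mathbb{R}^{n\times n})$, $B,D\in C([0,T];\mathbb{R}^{n\times m})$, $G\in C([0,T];\mathbb{S}^n)$, $Q\in C([0,T]^2;\mathbb{S}^n)$, $R\in C([0,T]^2;\mathbb{S}^m)$. Assume: (i) there is a constant $\delta>0$ such that $Q(t,s)\ge 0$, $R(t,s)\ge \delta I$, $G(t)\ge 0$ for all $0\le t\le s\le T$; (ii) there are positive definite matrices $\widehat Q,\widehat R,\widehat G$ such that for all $0\le t\le r\le s\le T$, $Q(t,s)\le Q(r,s)\le\widehat Q$, $R(t,s)\le R(r,s)\le\widehat R$, $G(t)\le G(r)\le\widehat G$; (iii) $G\in C^1([0,T];\mathbb{S}^n)$, and $Q(t,s)$ and $R(t,s)$ are continuously differentiable with respect to $t$ over $\{(t,s): 0\le t\le s\le T\}$. Then there exists $\kappa\in(0,T]$ such that the equilibrium Riccati equation $$\begin{cases}\partial_sP(t,s)+P(t,s)A_\Theta(s)+A_\Theta(s)^\top P(t,s)+C_\Theta(s)^\top P(t,s)C_\Theta(s)\\ \qquad+Q(t,s)+\Theta(s)^\top R(t,s)\Theta(s)=0,\quad T-\kappa\le t\le s\le T,\\ P(t,T)=G(t),\quad T-\kappa\le t\le T,\end{cases}$$ where $$\Theta(s)=-[R(s,s)+D(s)^\top P(s,s)D(s)]^{-1}[B(s)^\top P(s,s)+D(s)^\top P(s,s)C(s)],$$ $$A_\Theta(s)=A(s)+B(s)\Theta(s),\qquad C_\Theta(s)=C(s)+D(s)\Theta(s),$$ admits a unique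 solution $P\in C(\Delta^*[T-\kappa,T];\mathbb{S}^n_+)$. Moreover, for this solution $P$, the function $\Theta(s)=-[R(s,s)+D(s)^\top P(s,s)D(s)]^{-1}[B(s)^\top P(s,s)+D(s)^\top P(s,s)C(s)]$, $s\in[T-\kappa,T]$, belongs to $C([T-\kappa,T];\mathbb{R}^{m\times n})$.
   Context: $\mathbb{S}^n$ is the space of symmetric real $n\times n$ matrices, $\mathbb{S}^n_+$ the subset of positive semi-definite ones, and inequalities between symmetric matrices are in the positive semi-definite (Loewner) order. For $0\le t_1\le t_2\le T$, $\Delta^*[t_1,t_2]=\{(t,s)\in[t_1,t_2]^2: t\le s\}$; $C(\Delta^*[t_1,t_2];\mathbb{S}^n_+)$ is the set of continuous functions on $\Delta^*[t_1,t_2]$ with values in $\mathbb{S}^n_+$. The equation is non-local: the coefficient $\Theta(s)$ depends on the unknown $P$ through its diagonal value $P(s,s)$. A solution is a function $P$ such that, for each $t$, $s\mapsto P(t,s)$ is differentiable on $[t,T]$ and satisfies the displayed equation and terminal condition. *)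

(* Defs.v *)
From HB Require Import structures.
From mathcomp Require Import all_boot all_order all_algebra.
From mathcomp Require Import all_classical all_reals all_analysis.

Set Implicit Arguments.
Unset Strict Implicit.
Unset Printing Implicit Defensive.
Import Order.TTheory GRing.Theory Num.Theory numFieldNormedType.Exports.
Local Open Scope classical_set_scope.
Local Open Scope ring_scope.

(* Functions on an interval or a plane region are total functions, of which
   only the values on that region matter. *)

Section Matrices.
Context {R : realType} {n : nat}.
Implicit Types M N : 'M[R]_n.

Definition psdmx M : Prop :=
  M \is symmetricmx /\ forall x : 'cV[R]_n, 0 <= (x^T *m M *m x) 0 0.

Definition pdmx M : Prop :=
  M \is symmetricmx /\ forall x : 'cV[R]_n, x != 0 -> 0 < (x^T *m M *m x) 0 0.

Definition loewner_le M N : Prop := psdmx (N - M).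

End Matrices.

Section Calculus.
Context {R : realType} {m n : nat}.

(* The derivative of f at x relative to the set D: two-sided when x is interior
   to D and one-sided at the end points when D is an interval.  If x is isolated
   in D the condition is void. *)
Definition is_derive_in (D : set R) (f : R -> 'M[R]_(m, n)) (x : R)
    (l : 'M[R]_(m, n)) : Prop :=
  (y - x)^-1 *: (f y - f x) @[y --> within D x^'] --> l.

Definition square (T : R) : set (R * R) := `[0, T] `*` `[0, T].

Definition triangle (t1 t2 : R) : set (R * R) :=
  [set p | t1 <= p.1 /\ p.1 <= p.2 /\ p.2 <= t2].

Definition continuous2_in (D : set (R * R)) (F : R -> R -> 'M[R]_(m, n)) : Prop :=
  {within D, continuous (fun p : R * R => F p.1 p.2)}.

Definition C1_on (a b : R) (f : R -> 'M[R]_(m, n)) : Prop :=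
  exists df : R -> 'M[R]_(m, n),
    {within `[a, b], continuous df} /\
    forall t, t \in `[a, b] -> is_derive_in `[a, b] f t (df t).

(* For fixed s the first variable of the triangle ranges over [0, s].  At the
   corner (0, 0), where this is a single point, only the existence of a
   continuous extension of the partial derivative is required. *)
Definition C1_fst_on_triangle (T : R) (F : R -> R -> 'M[R]_(m, n)) : Prop :=
  exists dF : R -> R -> 'M[R]_(m, n),
    continuous2_in (triangle 0 T) dF /\
    forall t s, 0 <= t -> t <= s -> s <= T ->
      is_derive_in `[0, s] (fun r => F r s) t (dF t s).

End Calculus.

Section Riccati.
Context {R : realType} {n m : nat}.
Variables (A C : R -> 'M[R]_n) (B D : R -> 'M[R]_(n, m)).
Variables (G : R -> 'M[R]_n) (Q : R -> R -> 'M[R]_n) (Rw : R -> R -> 'M[R]_m).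
Implicit Types P : R -> R -> 'M[R]_n.

Definition Theta P (s : R) : 'M[R]_(m, n) :=
  - (invmx (Rw s s + (D s)^T *m P s s *m D s)
     *m ((B s)^T *m P s s + (D s)^T *m P s s *m C s)).

Definition A_Theta P (s : R) : 'M[R]_n := A s + B s *m Theta P s.

Definition C_Theta P (s : R) : 'M[R]_n := C s + D s *m Theta P s.

Definition riccati_solution (T kappa : R) P : Prop :=
  [/\ continuous2_in (triangle (T - kappa) T) P,
      forall t s, T - kappa <= t -> t <= s -> s <= T -> psdmx (P t s),
      forall t s, T - kappa <= t -> t <= s -> s <= T ->
        exists dP : 'M[R]_n,
          is_derive_in `[t, T] (P t) s dP /\
          dP + P t s *m A_Theta P s + (A_Theta P s)^T *m P t s
            + (C_Theta P s)^T *m P t s *m C_Theta P s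
            + Q t s + (Theta P s)^T *m Rw t s *m Theta P s = 0
    & forall t, T - kappa <= t -> t <= T -> P t T = G t].

End Riccati.

(* Main.v *)
Require Import Defs.
From HB Require Import structures.
From mathcomp Require Import all_boot all_order all_algebra.
From mathcomp Require Import all_classical all_reals all_analysis.
From mathcomp Require Import ring lra.

Set Implicit Arguments.
Unset Strict Implicit.
Unset Printing Implicit Defensive.
Import Order.TTheory GRing.Theory Num.Theory numFieldNormedType.Exports.
Local Open Scope classical_set_scope.
Local Open Scope ring_scope.

(* Near the final time the map P |-> G(t) + int_s^T (right-hand side) is a
   contraction on the continuous symmetric functions within a small distance of
   G(T): there R(s,s) + D^T P D stays uniformly coercive, so that Theta is a
   bounded Lipschitz function of P(s,s), and a short interval makes the constant
   less than one half.  The fixed point is positive semidefinite because it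
   solves a linear Lyapunov equation with nonnegative data, and any two solutions
   agree by a Gronwall estimate on the triangle.  The coefficients are first
   extended continuously to the whole line by clamping the time to [0, T]. *)

(** * Matrix norms and quadratic forms *)

(** The feedback at time [s] uses the diagonal value [P(s,s)], so the equation for a single [t] is
    not closed: the Picard map acts on functions of both times at once, and each Lipschitz estimate
    counts the unknown twice. The main obstacle is the inverse in [Theta], controlled only while
    [R(s,s) + D^T P D] is coercive, whereas a Picard step does not visibly preserve positivity of
    [P]. Coercivity is therefore obtained in two ways. During the iteration it comes from closeness
    to [G(T)], at the price of half of [delta]; for an arbitrary solution, which need not stay close
    to [G(T)], it comes from the positivity required of a solution. The positivity proof is not
    circular, since [Theta] is frozen along the fixed point already found. All nine matrices
    entering at [(t,s)] are gathered in one record, and the right-hand side is a bounded Lipschitz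
    function of that record by closure under sums, products and coercive inverses. The matrix norm
    is the entrywise maximum, which is why dimensions appear in the constants. *)

Section MatrixNorm.
Context {R : realFieldType}.

Lemma mx_norm_ge_entry m n (M : 'M[R]_(m, n)) i j : `|M i j| <= `|M|.
Proof.
rewrite [leRHS]/Num.norm /= mx_normrE.
by rewrite (le_bigmax _ (fun ij : 'I_m * 'I_n => `|M ij.1 ij.2|) (i, j)).
Qed.

Lemma mx_norm_le m n (M : 'M[R]_(m, n)) c :
  0 <= c -> (forall i j, `|M i j| <= c) -> `|M| <= c.
Proof.
move=> c0 Mc; rewrite [leLHS]/Num.norm /= mx_normrE.
by apply/bigmax_leP; split=> // -[i j] _; exact: Mc.
Qed.

Lemma mx_norm_mul m n p (M : 'M[R]_(m, n)) (N : 'M[R]_(n, p)) :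
  `|M *m N| <= n%:R * `|M| * `|N|.
Proof.
apply: mx_norm_le => [|i j]; first by rewrite !mulr_ge0.
rewrite mxE; apply: le_trans (ler_norm_sum _ _ _) _.
apply: le_trans (_ : \sum_(k < n) `|M| * `|N| <= _).
  by apply: ler_sum => k _; rewrite normrM ler_pM// mx_norm_ge_entry.
by rewrite sumr_const card_ord -[leLHS]mulr_natl mulrA.
Qed.

Lemma mx_norm_tr m n (M : 'M[R]_(m, n)) : `|M^T| = `|M|.
Proof.
apply/eqP; rewrite eq_le; apply/andP; split.
  by apply: mx_norm_le => // i j; rewrite mxE mx_norm_ge_entry.
apply: mx_norm_le => // i j; have := mx_norm_ge_entry M^T j i.
by rewrite mxE.
Qed.

End MatrixNorm.

Section QuadraticForm.
Context {R : realFieldType}.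

Definition qform n (M : 'M[R]_n) (x : 'cV[R]_n) : R := (x^T *m M *m x) 0 0.

Definition sqnorm n (x : 'cV[R]_n) : R := (x^T *m x) 0 0.

Lemma sqnormE n (x : 'cV[R]_n) : sqnorm x = \sum_i x i 0 ^+ 2.
Proof. by rewrite /sqnorm mxE; apply: eq_bigr => i _; rewrite mxE expr2. Qed.

Lemma sqnorm_ge0 n (x : 'cV[R]_n) : 0 <= sqnorm x.
Proof. by rewrite sqnormE sumr_ge0// => i _; rewrite sqr_ge0. Qed.

Lemma sqnorm_ge_entry n (x : 'cV[R]_n) i : x i 0 ^+ 2 <= sqnorm x.
Proof.
rewrite sqnormE (bigD1 i)//= lerDl sumr_ge0// => j _.
by rewrite sqr_ge0.
Qed.

Lemma sqnorm_eq0 n (x : 'cV[R]_n) : sqnorm x <= 0 -> x = 0.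
Proof.
move=> x0; apply/colP => i; rewrite mxE; apply/eqP.
rewrite -sqrf_eq0 eq_le sqr_ge0 andbT.
exact: le_trans (sqnorm_ge_entry x i) x0.
Qed.

Lemma qformD n (M N : 'M[R]_n) x : qform (M + N) x = qform M x + qform N x.
Proof. by rewrite /qform mulmxDr mulmxDl mxE. Qed.

Lemma qformN n (M : 'M[R]_n) x : qform (- M) x = - qform M x.
Proof. by rewrite /qform mulmxN mulNmx mxE. Qed.

Lemma qformB n (M N : 'M[R]_n) x : qform (M - N) x = qform M x - qform N x.
Proof. by rewrite qformD qformN. Qed.

Lemma qformZ n a (M : 'M[R]_n) x : qform (a *: M) x = a * qform M x.
Proof. by rewrite /qform -scalemxAr -scalemxAl mxE. Qed.

Lemma qform_scalar n a (x : 'cV[R]_n) : qform a%:M x = a * sqnorm x.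
Proof.
by rewrite /qform /sqnorm -mulmxA mul_scalar_mx -scalemxAr mxE.
Qed.

Lemma qform_congr n p (M : 'M[R]_n) (N : 'M[R]_(n, p)) x :
  qform (N^T *m M *m N) x = qform M (N *m x).
Proof. by rewrite /qform trmx_mul !mulmxA. Qed.

Lemma qform_tr n (M : 'M[R]_n) x : qform M^T x = qform M x.
Proof.
rewrite /qform; transitivity ((x^T *m M *m x)^T 0 0); last by rewrite mxE.
by rewrite !trmx_mul trmxK mulmxA.
Qed.

(** Each product of two coordinates is at most the mean of their squares; in the double sum every
    square is then counted [n] times. *)
Lemma qform_norm n (M : 'M[R]_n) x : `|qform M x| <= n%:R * `|M| * sqnorm x.
Proof.
have -> : qform M x = \sum_i \sum_j x j 0 * M j i * x i 0.
  rewrite /qform mxE; apply: eq_bigr => i _.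
  by rewrite mxE mulr_suml; apply: eq_bigr => j _; rewrite mxE.
apply: le_trans (_ : \sum_i \sum_j `|M| * ((x i 0 ^+ 2 + x j 0 ^+ 2) / 2) <= _).
  apply: le_trans (ler_norm_sum _ _ _) _; apply: ler_sum => i _.
  apply: le_trans (ler_norm_sum _ _ _) _; apply: ler_sum => j _.
  rewrite !normrM mulrAC [leLHS]mulrC ler_pM ?mulr_ge0 ?mx_norm_ge_entry//.
  rewrite -(real_normK (num_real (x i 0))) -(real_normK (num_real (x j 0))).
  have := sqr_ge0 (`|x j 0| - `|x i 0|); nra.
rewrite le_eqVlt; apply/orP; left; apply/eqP.
under eq_bigr do rewrite -mulr_sumr -mulr_suml big_split/= sumr_const card_ord.
rewrite -mulr_sumr -mulr_suml big_split/= -sqnormE.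
rewrite sumr_const card_ord sumrMnl -sqnormE.
rewrite -mulr2n -[X in X / 2]mulr_natr mulfK ?pnatr_eq0//.
by rewrite -[X in _ * X]mulr_natl mulrCA mulrA.
Qed.

Definition coercive n (d : R) (M : 'M[R]_n) : Prop :=
  forall x, d * sqnorm x <= qform M x.

(** A row of [kermx M^T], transposed, is a vector killed by [M]; coercivity forces its square norm
    to vanish. *)
Lemma coercive_unitmx n d (M : 'M[R]_n) : 0 < d -> coercive d M -> M \in unitmx.
Proof.
move=> d0 Md; rewrite -unitmx_tr -row_free_unit -kermx_eq0.
apply/eqP/row_matrixP => i; rewrite row0; apply: trmx_inj; rewrite trmx0.
apply: sqnorm_eq0; rewrite -(pmulr_rle0 _ d0).
apply: le_trans (Md _) _.
have Mx : M *m (row i (kermx M^T))^T = 0.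
  by apply: trmx_inj; rewrite trmx_mul trmxK -row_mul mulmx_ker row0 trmx0.
by rewrite /qform -mulmxA Mx mulmx0 mxE.
Qed.

(** The [j]-th column [x] of the inverse solves [M x = e_j], so coercivity reads [d |x|^2 <= x_j].
    This gives first [x_j <= d^-1], then [|x| <= d^-1]. *)
Lemma coercive_invmx_norm n d (M : 'M[R]_n) :
  0 < d -> coercive d M -> `|invmx M| <= d^-1.
Proof.
move=> d0 Md; have uM := coercive_unitmx d0 Md.
apply: mx_norm_le => [|i j]; first by rewrite invr_ge0 ltW.
pose x := col j (invmx M).
have xE k : invmx M k j = x k 0 by rewrite mxE.
have qx : qform M x = x j 0.
  have Mx : M *m x = delta_mx j 0 by rewrite /x colE mulmxA mulmxV// mul1mx.
  by rewrite /qform -mulmxA Mx -colE mxE [LHS]mxE.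
have := Md x; rewrite qx => xj.
have di := divff (lt0r_neq0 d0); have dV : 0 < d^-1 by rewrite invr_gt0.
have hj := sqnorm_ge_entry x j; have hi := sqnorm_ge_entry x i.
have xj0 : 0 <= x j 0.
  by apply: le_trans xj; rewrite mulr_ge0 ?sqnorm_ge0// ltW.
have xj1 : x j 0 <= d^-1.
  rewrite leNgt; apply/negP => xd.
  suff : d * x j 0 ^+ 2 > x j 0 by nra.
  have : d * x j 0 > 1 by rewrite -di ltr_pM2l.
  have : 0 < x j 0 by exact: lt_trans xd.
  nra.
have sx : sqnorm x <= d^-1 ^+ 2.
  rewrite -(ler_pM2l d0) expr2 mulrA di mul1r; exact: le_trans xj _.
rewrite xE -ler_sqr ?nnegrE ?(ltW dV)// real_normK ?num_real//.
exact: le_trans hi sx.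
Qed.

End QuadraticForm.

(** * Lipschitz dependence of the equation on its data *)

Section BoundedLipschitz.
Context {R : realFieldType} {Z : Type}.
Variable dist : Z -> Z -> R.
Hypothesis dist_ge0 : forall z z', 0 <= dist z z'.
Implicit Type D : set Z.

(** Boundedness and the Lipschitz property are kept together because products preserve the pair but
    not the Lipschitz property alone. *)
Definition bdd_lip p q D (f : Z -> 'M[R]_(p, q)) : Prop :=
  exists K : R, [/\ 0 <= K, forall z, D z -> `|f z| <= K &
    forall z z', D z -> D z' -> `|f z - f z'| <= K * dist z z'].

Lemma bdd_lipD p q D (f g : Z -> 'M[R]_(p, q)) :
  bdd_lip D f -> bdd_lip D g -> bdd_lip D (fun z => f z + g z).
Proof.
move=> [K [K0 fK fL]] [H [H0 gH gL]]; exists (K + H).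
split=> [|z Dz|z z' Dz Dz']; first exact: addr_ge0.
  by apply: le_trans (ler_normD _ _) _; rewrite lerD ?fK ?gH.
rewrite opprD addrACA mulrDl; apply: le_trans (ler_normD _ _) _.
by rewrite lerD ?fL ?gL.
Qed.

Lemma bdd_lipN p q D (f : Z -> 'M[R]_(p, q)) :
  bdd_lip D f -> bdd_lip D (fun z => - f z).
Proof.
move=> [K [K0 fK fL]]; exists K; split=> // [z Dz|z z' Dz Dz'].
  by rewrite normrN fK.
by rewrite -opprD normrN fL.
Qed.

Lemma bdd_lip_tr p q D (f : Z -> 'M[R]_(p, q)) :
  bdd_lip D f -> bdd_lip D (fun z => (f z)^T).
Proof.
move=> [K [K0 fK fL]]; exists K; split=> // [z Dz|z z' Dz Dz'].
  by rewrite mx_norm_tr fK.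
by rewrite -linearB mx_norm_tr fL.
Qed.

Lemma bdd_lipM p q r D (f : Z -> 'M[R]_(p, q)) (g : Z -> 'M[R]_(q, r)) :
  bdd_lip D f -> bdd_lip D g -> bdd_lip D (fun z => f z *m g z).
Proof.
move=> [K [K0 fK fL]] [H [H0 gH gL]]; exists (q%:R * K * H * 2).
have q0 : 0 <= q%:R :> R by [].
split=> [|z Dz|z z' Dz Dz']; first by rewrite !mulr_ge0.
  apply: le_trans (mx_norm_mul _ _) _.
  apply: le_trans (_ : q%:R * K * H <= _).
    by rewrite ler_pM ?mulr_ge0// ?ler_pM ?fK ?gH.
  by rewrite ler_peMr ?mulr_ge0// ler1n.
have -> : f z *m g z - f z' *m g z' = f z *m (g z - g z') + (f z - f z') *m g z'.
  by rewrite mulmxBr mulmxBl addrA subrK.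
have -> : q%:R * K * H * 2 * dist z z' =
    q%:R * K * (H * dist z z') + q%:R * (K * dist z z') * H by ring.
apply: le_trans (ler_normD _ _) _; apply: lerD.
  apply: le_trans (mx_norm_mul _ _) _.
  by rewrite ler_pM ?mulr_ge0 ?gL// ler_pM ?fK.
apply: le_trans (mx_norm_mul _ _) _.
by rewrite ler_pM ?mulr_ge0 ?gH// ler_pM ?fL.
Qed.

(** Resolvent identity [M^-1 - N^-1 = M^-1 (N - M) N^-1], both inverses being bounded by [d^-1]. *)
Lemma bdd_lip_inv n D (f : Z -> 'M[R]_n) d :
  0 < d -> (forall z, D z -> coercive d (f z)) ->
  bdd_lip D f -> bdd_lip D (fun z => invmx (f z)).
Proof.
move=> d0 cf [K [K0 fK fL]]; have dV0 : 0 <= d^-1 by rewrite invr_ge0 ltW.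
exists (d^-1 + n%:R * (n%:R * d^-1 * K) * d^-1).
split=> [|z Dz|z z' Dz Dz']; first by rewrite addr_ge0// !mulr_ge0.
  apply: le_trans (coercive_invmx_norm d0 (cf z Dz)) _.
  by rewrite lerDl !mulr_ge0.
have -> : invmx (f z) - invmx (f z') =
    invmx (f z) *m (f z' - f z) *m invmx (f z').
  rewrite mulmxBr mulmxBl mulVmx ?(coercive_unitmx d0 (cf z Dz))//.
  by rewrite mul1mx mulmxK// (coercive_unitmx d0 (cf z' Dz')).
apply: le_trans (mx_norm_mul _ _) _.
apply: le_trans (_ : n%:R * (n%:R * d^-1 * (K * dist z z')) * d^-1 <= _).
  rewrite ler_pM ?mulr_ge0 ?(coercive_invmx_norm d0 (cf z' Dz'))//.
  rewrite ler_pM//; apply: le_trans (mx_norm_mul _ _) _.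
  rewrite ler_pM ?mulr_ge0 ?(distrC (f z')) ?fL// ler_pM//.
  exact: coercive_invmx_norm d0 (cf z Dz).
rewrite mulrDl; set u := dist z z'.
have -> : n%:R * (n%:R * d^-1 * (K * u)) * d^-1 =
  n%:R * (n%:R * d^-1 * K) * d^-1 * u by ring.
by rewrite lerDr mulr_ge0// /u.
Qed.

End BoundedLipschitz.

(** [Z] carries no topology, so the continuity of [z] is expressed through [dist]. *)
Lemma bdd_lip_continuous (R : realFieldType) (Z : Type) (dist : Z -> Z -> R)
    p q D (f : Z -> 'M[R]_(p, q)) (T : topologicalType) (z : T -> Z) :
  bdd_lip dist D f -> (forall t, D (z t)) ->
  (forall t e, 0 < e -> \forall t' \near t, dist (z t) (z t') <= e) ->
  continuous (fun t => f (z t)).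
Proof.
move=> [K [K0 fK fL]] Dz cz t; apply/cvgrPdist_le => e e0.
have eK : 0 < e / (K + 1) by rewrite divr_gt0// ltr_wpDl.
have := cz t _ eK; apply: filterS => t' tt'.
apply: le_trans (fL _ _ _ _) _ => //.
apply: le_trans (_ : K * (e / (K + 1)) <= _); first by rewrite ler_wpM2l.
by rewrite mulrCA ger_pMr// ler_pdivrMr ?ltr_wpDl// mul1r lerDl.
Qed.

Section Coefficients.
Context {R : realFieldType} {n m : nat}.

(* The values of A(s), B(s), C(s), D(s), Q(t,s), R(t,s), R(s,s), P(t,s), P(s,s)
   that enter the equation at (t,s). *)
Record data := Data {
  dA : 'M[R]_n; dB : 'M[R]_(n, m); dC : 'M[R]_n; dD : 'M[R]_(n, m);
  dQ : 'M[R]_n; dR : 'M[R]_m; dRd : 'M[R]_m; dP : 'M[R]_n; dPd : 'M[R]_n }.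
Implicit Type z : data.

Definition ddist z z' : R :=
  `|dA z - dA z'| + `|dB z - dB z'| + `|dC z - dC z'| + `|dD z - dD z'| +
  `|dQ z - dQ z'| + `|dR z - dR z'| + `|dRd z - dRd z'| + `|dP z - dP z'| +
  `|dPd z - dPd z'|.

Definition dnorm z : R :=
  `|dA z| + `|dB z| + `|dC z| + `|dD z| + `|dQ z| + `|dR z| + `|dRd z| +
  `|dP z| + `|dPd z|.

Lemma ddist_ge0 z z' : 0 <= ddist z z'.
Proof. by rewrite /ddist !addr_ge0. Qed.

(** This is the matrix that [dTheta] inverts, not its inverse. *)
Definition dThetaInv z : 'M[R]_m := dRd z + (dD z)^T *m dPd z *m dD z.
Definition dTheta z : 'M[R]_(m, n) :=
  - (invmx (dThetaInv z) *m ((dB z)^T *m dPd z + (dD z)^T *m dPd z *m dC z)).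
Definition dAT z : 'M[R]_n := dA z + dB z *m dTheta z.
Definition dCT z : 'M[R]_n := dC z + dD z *m dTheta z.
Definition drhs z : 'M[R]_n :=
  dP z *m dAT z + (dAT z)^T *m dP z + (dCT z)^T *m dP z *m dCT z
  + dQ z + (dTheta z)^T *m dR z *m dTheta z.

(** Coercivity is imposed on the whole matrix to be inverted, so that one family of domains serves
    both the ball around [G T] (with [delta / 2]) and positive semidefinite solutions (with
    [delta]). *)
Definition data_dom (K d : R) : set data :=
  [set z | dnorm z <= K /\ coercive d (dThetaInv z)].

Lemma bdd_lip_proj (K d : R) p q (f : data -> 'M[R]_(p, q)) :
  (forall z, `|f z| <= dnorm z) -> (forall z z', `|f z - f z'| <= ddist z z') ->
  bdd_lip ddist (data_dom K d) f.
Proof.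
(* One constant must be a nonnegative bound, whatever the sign of [K], and a Lipschitz constant at
   least 1. *)
move=> fn fd; exists (`|K| + 1); split=> [|z [Kz _]|z z' _ _].
- by rewrite addr_ge0.
- apply: le_trans (fn z) _; apply: le_trans Kz _; rewrite ler_wpDr//.
  exact: ler_norm.
- by apply: le_trans (fd _ _) _; rewrite ler_peMl ?ddist_ge0// lerDr.
Qed.

Ltac proj_tac := apply: bdd_lip_proj => [z|z z']; rewrite /dnorm /ddist;
  repeat (match goal with |- is_true (?x <= ?x + _) => by rewrite lerDl
    | |- is_true (?x <= _ + ?x) => by rewrite lerDr ?addr_ge0
    | |- is_true (_ <= _ + _) => apply: ler_wpDr; first by [] end).

Lemma bdd_lip_dTheta K d : 0 < d -> bdd_lip ddist (data_dom K d) dTheta.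
Proof.
move=> d0.
have bB : bdd_lip ddist (data_dom K d) dB by proj_tac.
have bC : bdd_lip ddist (data_dom K d) dC by proj_tac.
have bD : bdd_lip ddist (data_dom K d) dD by proj_tac.
have bRd : bdd_lip ddist (data_dom K d) dRd by proj_tac.
have bPd : bdd_lip ddist (data_dom K d) dPd by proj_tac.
apply/bdd_lipN/bdd_lipM; last first.
  by apply: bdd_lipD; repeat apply: bdd_lipM => //; apply: bdd_lip_tr.
apply: (bdd_lip_inv ddist_ge0 d0) => [z []//|].
by apply: bdd_lipD => //; repeat apply: bdd_lipM => //; apply: bdd_lip_tr.
Qed.

Lemma bdd_lip_dAT K d : 0 < d -> bdd_lip ddist (data_dom K d) dAT.
Proof.
move=> d0; apply: bdd_lipD; first by proj_tac.
apply: bdd_lipM; first by proj_tac.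
exact: bdd_lip_dTheta.
Qed.

Lemma bdd_lip_dCT K d : 0 < d -> bdd_lip ddist (data_dom K d) dCT.
Proof.
move=> d0; apply: bdd_lipD; first by proj_tac.
apply: bdd_lipM; first by proj_tac.
exact: bdd_lip_dTheta.
Qed.

Lemma bdd_lip_drhs K d : 0 < d -> bdd_lip ddist (data_dom K d) drhs.
Proof.
move=> d0.
have bT := bdd_lip_dTheta K d0.
have bAT := bdd_lip_dAT K d0.
have bCT := bdd_lip_dCT K d0.
have bP : bdd_lip ddist (data_dom K d) dP by proj_tac.
have bQ : bdd_lip ddist (data_dom K d) dQ by proj_tac.
have bR : bdd_lip ddist (data_dom K d) dR by proj_tac.
apply: bdd_lipD; last by repeat apply: bdd_lipM => //; exact: bdd_lip_tr.
apply: bdd_lipD => //.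
apply: bdd_lipD; last by repeat apply: bdd_lipM => //; exact: bdd_lip_tr.
by apply: bdd_lipD; apply: bdd_lipM => //; exact: bdd_lip_tr.
Qed.

End Coefficients.

(** * Derivatives of matrix functions *)

Section Clamp.
Context {R : realType}.

Definition clamp (a b x : R) : R := Num.max a (Num.min x b).

Lemma clamp_itv a b x : a <= b -> a <= clamp a b x <= b.
Proof. by move=> ab; rewrite /clamp le_max lexx/= ge_max ab ge_min lexx orbT. Qed.

Lemma clamp_id a b x : a <= x -> x <= b -> clamp a b x = x.
Proof. by move=> ax xb; rewrite /clamp min_l// max_r. Qed.

Lemma continuous_clamp a b : continuous (clamp a b).
Proof.
move=> x; apply: (@continuous_max _ _ (cst a) (fun x => Num.min x b)).
  exact: cst_continuous.
apply: (@continuous_min _ _ id (cst b)); first by move=> ?.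
exact: cst_continuous.
Qed.

End Clamp.

(** With [c] a clamping map, relative continuity on an interval or a square becomes continuity on
    the whole space. *)
Lemma continuous_comp_within (S T U : topologicalType) (A : set T) (f : T -> U)
    (c : S -> T) :
  {within A, continuous f} -> continuous c -> (forall x, A (c x)) ->
  continuous (f \o c).
Proof.
move=> /subspace_continuousP fA cc Ac x; apply: cvg_comp (fA _ (Ac x)).
move=> V AV; suff : nbhs x (c @^-1` V) by [].
by apply: (@filterS _ (nbhs x) _ _ _ _ (cc x _ AV)) => y yV; exact: yV (Ac y).
Qed.

Section Derivatives.
Context {R : realType}.

(** Multiplying by [y - x] removes the punctured neighbourhood: the linearised form also holds at
    [y = x], so it can be added and restricted by plain filter arguments. *)
Lemma is_derive_inP m n (D : set R) (f : R -> 'M[R]_(m, n)) (x : R) (l : 'M[R]_(m, n)) :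
  is_derive_in D f x l <-> forall e, 0 < e -> \forall y \near x,
    D y -> `|f y - f x - (y - x) *: l| <= e * `|y - x|.
Proof.
split=> [/cvgrPdist_le fl e e0|fl].
  have fle : nbhs x (fun y => y != x -> D y ->
    `|l - (y - x)^-1 *: (f y - f x)| <= e) := fl e e0.
  apply: filterS fle => y yl Dy; have [->|yx] := eqVneq y x.
    by rewrite !subrr scale0r subr0 !normr0 mulr0.
  have yx0 : y - x != 0 by rewrite subr_eq0.
  have := yl yx Dy; rewrite -(ler_pM2r (_ : 0 < `|y - x|)) ?normr_gt0//.
  rewrite mulrC -normrZ scalerBr scalerA divff// scale1r.
  by rewrite distrC.
apply/cvgrPdist_le => e e0.
suff : nbhs x (fun y => y != x -> D y ->
    `|l - (y - x)^-1 *: (f y - f x)| <= e) by [].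
apply: filterS (fl e e0) => y yl yx /yl.
have yx0 : y - x != 0 by rewrite subr_eq0.
rewrite -(ler_pM2r (_ : 0 < `|y - x|^-1)) ?invr_gt0 ?normr_gt0// mulfK ?normr_eq0//.
by rewrite mulrC -normfV -normrZ scalerBr scalerA mulVf// scale1r distrC.
Qed.

Lemma is_derive1P (f : R -> R) (x l : R) :
  is_derive x 1 f l <-> forall e, 0 < e -> \forall y \near x,
    `|f y - f x - (y - x) * l| <= e * `|y - x|.
Proof.
rewrite is_derive1_caratheodory; split=> [[g [fg gx gl]] e e0|fl].
  move/cvgrPdist_le : gx => /(_ e e0); apply: filterS => y.
  by rewrite fg -gl mulrC -mulrBr normrM mulrC distrC => /ler_wpM2r; exact.
exists (fun y => if y == x then l else (f y - f x) / (y - x)); split.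
- move=> y; case: eqVneq => [->|yx]; first by rewrite !subrr mulr0.
  by rewrite divfK// subr_eq0.
- rewrite /prop_for /continuous_at eqxx.
  apply/cvgrPdist_le => e e0; apply: filterS (fl e e0) => y.
  case: eqVneq => [_ _|yx]; first by rewrite subrr normr0 ltW.
  have yx0 : y - x != 0 by rewrite subr_eq0.
  rewrite -ler_pdivrMr ?normr_gt0// -normfV -normrM mulrBl mulrAC divff// mul1r.
  by rewrite distrC.
- by rewrite eqxx.
Qed.

Lemma is_derive_in_entries m n (D : set R) (f : R -> 'M[R]_(m, n)) (x : R)
    (l : 'M[R]_(m, n)) :
  (forall i j, is_derive x 1 (fun y => f y i j) (l i j)) -> is_derive_in D f x l.
Proof.
move=> fl; apply/is_derive_inP => e e0.
have /filter_forall : forall ij : 'I_m * 'I_n, \forall y \near x,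
    `|f y ij.1 ij.2 - f x ij.1 ij.2 - (y - x) * l ij.1 ij.2| <= e * `|y - x|.
  by move=> ij; exact: (is_derive1P _ _ _).1 (fl ij.1 ij.2) e e0.
apply: filterS => y yl _.
apply: mx_norm_le => [|i j]; first by rewrite mulr_ge0// ltW.
by rewrite !mxE; exact: yl (i, j).
Qed.

Lemma is_derive_in_sub m n (D D' : set R) (f : R -> 'M[R]_(m, n)) (x : R)
    (l : 'M[R]_(m, n)) :
  D' `<=` D -> is_derive_in D f x l -> is_derive_in D' f x l.
Proof.
move=> DD /is_derive_inP fl; apply/is_derive_inP => e /fl.
by apply: filterS => y yl /DD.
Qed.

Lemma is_derive_inB m n (D : set R) (f g : R -> 'M[R]_(m, n))
    (x : R) (k l : 'M[R]_(m, n)) :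
  is_derive_in D f x k -> is_derive_in D g x l ->
  is_derive_in D (fun y => f y - g y) x (k - l).
Proof.
move=> /is_derive_inP fk /is_derive_inP gl; apply/is_derive_inP => e e0.
have e20 : 0 < e / 2 by rewrite divr_gt0.
apply: filterS2 (fk _ e20) (gl _ e20) => y yk yl Dy.
have -> : f y - g y - (f x - g x) - (y - x) *: (k - l) =
    (f y - f x - (y - x) *: k) - (g y - g x - (y - x) *: l).
  by apply/matrixP => i j; rewrite !mxE; ring.
apply: le_trans (ler_normB _ _) _.
by rewrite [leRHS](_ : _ = e / 2 * `|y - x| + e / 2 * `|y - x|) ?lerD ?yk ?yl//; field.
Qed.

Lemma is_derive_in_continuous m n (D : set R) (f : R -> 'M[R]_(m, n)) df :
  (forall x, D x -> is_derive_in D f x (df x)) -> {within D, continuous f}.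
Proof.
move=> fd; apply/subspace_continuousP => x Dx.
have /is_derive_inP/(_ 1 ltr01) fx := fd x Dx.
apply/cvgrPdist_le => e e0; rewrite /within/= ?near_simpl.
have d0 : 0 < e / (`|df x| + 1) by rewrite divr_gt0// ltr_wpDl.
have := nbhsx_ballx x _ d0; rewrite -nearE; move: fx.
apply: filterS2 => y fy xy Dy.
have -> : f x - f y = - ((f y - f x - (y - x) *: df x) + (y - x) *: df x).
  by rewrite subrK opprB.
rewrite normrN; apply: le_trans (ler_normD _ _) _.
rewrite normrZ; apply: le_trans (lerD (fy Dy) (lexx _)) _.
rewrite mul1r -[X in X + _]mulr1 -mulrDr [1 + _]addrC -ler_pdivlMr ?ltr_wpDl//.
by move: xy; rewrite -ball_normE /= distrC => /ltW.
Qed.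

Lemma is_derive_in_interior m n a b (f : R -> 'M[R]_(m, n)) (x : R)
    (l : 'M[R]_(m, n)) i j :
  x \in `]a, b[ -> is_derive_in `[a, b] f x l ->
  is_derive x 1 (fun y => f y i j) (l i j).
Proof.
move=> xab /is_derive_inP fl; apply/is_derive1P => e e0.
have := near_in_itvoo xab; move: (fl e e0).
apply: filterS2 => y yl yab; apply: le_trans (yl _); last first.
  exact: subset_itv_oo_cc.
by apply: le_trans (mx_norm_ge_entry _ i j); rewrite !mxE.
Qed.

(** Entries of a matrix function share no mean value point, but the maximum norm allows the scalar
    theorem to be applied to [g - f_ij] and [g + f_ij] separately. A general majorant [g] admits the
    exponential weights of the Gronwall estimate. *)
Lemma mean_value_le m n (f df : R -> 'M[R]_(m, n)) (g dg : R -> R) a b :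
  a <= b -> (forall x, a <= x <= b -> is_derive_in `[a, b] f x (df x)) ->
  (forall x, a <= x <= b -> is_derive x 1 g (dg x)) ->
  (forall x, a <= x <= b -> `|df x| <= dg x) -> `|f b - f a| <= g b - g a.
Proof.
move=> ab fd gd fg.
have oc x : x \in `]a, b[ -> a <= x <= b.
  by rewrite in_itv/= => /andP[ax xb]; rewrite !ltW.
have cf : {within `[a, b], continuous f}.
  by apply: (@is_derive_in_continuous _ _ _ _ df) => x; rewrite /= in_itv; exact: fd.
have cfij i j : {within `[a, b], continuous (fun x => f x i j)}.
  move=> x; apply: (@continuous_comp (subspace `[a, b]) _ _ f
    (fun M : 'M[R]_(m, n) => M i j) x (cf x)).
  exact: coord_continuous.
have cg : {within `[a, b], continuous g}.
  apply: derivable_within_continuous => x; rewrite in_itv/= => /gd [].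
  by [].
have key (s : R) i j : `|s| = 1 -> s * (f b i j - f a i j) <= g b - g a.
  move=> s1; pose h x := g x - s * f x i j.
  have [x||c cab hE] := @MVT_segment R h (fun x => dg x - s * df x i j) a b ab.
  - move=> xab.
    have fx := is_derive_in_interior i j xab (fd x (oc x xab)).
    have gx := gd x (oc x xab).
    have hx : is_derive x 1 (g - s *: (fun y => f y i j)) (dg x - s *: df x i j).
      exact: is_deriveB.
    exact: hx.
  - move=> x; apply: cvgB; first exact: cg.
    by apply: cvgMr; exact: cfij.
  have : 0 <= h b - h a.
    rewrite hE mulr_ge0 ?subr_ge0//; apply: le_trans (fg c _); last first.
      by move: cab; rewrite in_itv.
    apply: le_trans (mx_norm_ge_entry _ i j).
    by rewrite -[leRHS]mul1r -s1 -normrM ler_norm.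
  by rewrite /h; lra.
(* For a matrix without entries [key] does not give [g a <= g b], so the mean value theorem is
   applied to [g] itself. *)
apply: mx_norm_le => [|i j].
  have [x xab||c cab ->] := @MVT_segment R g dg a b ab.
  - exact/gd/oc.
  - exact: cg.
  by rewrite mulr_ge0 ?subr_ge0// (le_trans _ (fg c _))// -in_itv.
rewrite !mxE ler_norml; apply/andP; split.
  by have := key (-1) i j (normrN1 _); lra.
by have := key 1 i j (normr1 _); lra.
Qed.

End Derivatives.

(** * Backward integrals *)

Section Primitive.
Context {R : realType} {m n : nat}.
Implicit Types f g : R -> 'M[R]_(m, n).

Lemma is_derive_Rintegral (h : R -> R) (a x : R) : continuous h -> a < x ->
  is_derive x 1 (fun y => \int[lebesgue_measure]_(t in `[a, y]) h t) (h x).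
Proof.
move=> ch ax; have xx : x < x + 1 by rewrite ltrDl.
have ih : lebesgue_measure.-integrable `[a, x + 1] (EFin \o h).
  apply: continuous_compact_integrable; first exact: segment_compact.
  exact: continuous_subspaceT.
have [dh hE] := continuous_FTC1_closed xx ih ax (ch x).
by split=> //; rewrite -derive1E.
Qed.

(* The integral of [f] from [s] to [b], with [s] clamped to [a, b].  The base point
   lies below [a] so that the fundamental theorem also applies at [a]. *)
Definition backward_integral (a b : R) f (s : R) : 'M[R]_(m, n) :=
  \matrix_(i, j)
    (\int[lebesgue_measure]_(t in `[a - 1, b]) f t i j
     - \int[lebesgue_measure]_(t in `[a - 1, clamp a b s]) f t i j).

Lemma backward_integral_clamp a b f s : a <= b ->
  backward_integral a b f (clamp a b s) = backward_integral a b f s.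
Proof.
move=> ab; have /andP[h1 h2] := clamp_itv s ab.
by rewrite /backward_integral [clamp a b (clamp a b s)]clamp_id.
Qed.

Lemma backward_integral_right a b f : a <= b -> backward_integral a b f b = 0.
Proof.
by move=> ab; apply/matrixP => i j; rewrite !mxE clamp_id// subrr.
Qed.

Lemma is_derive_backward_integral a b f s : continuous f -> a <= s <= b ->
  is_derive_in `[a, b] (backward_integral a b f) s (- f s).
Proof.
move=> cf /andP[as_ sb].
(* Without the clamp the integral has a two-sided derivative even at the end points, as [f] is
   continuous on the whole line. *)
pose F y : 'M[R]_(m, n) := \matrix_(i, j)
  (\int[lebesgue_measure]_(t in `[a - 1, b]) f t i j
     - \int[lebesgue_measure]_(t in `[a - 1, y]) f t i j).
have FE y : y \in `[a, b] -> backward_integral a b f y = F y.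
  rewrite in_itv/= => /andP[ay yb]; apply/matrixP => i j.
  by rewrite !mxE clamp_id.
have /is_derive_inP dF : is_derive_in `[a, b] F s (- f s).
  apply: is_derive_in_entries => i j.
  have cfij : continuous (fun t => f t i j).
    move=> t; apply: (@continuous_comp _ _ _ f (fun M : 'M[R]_(m, n) => M i j) t).
      exact: cf.
    exact: coord_continuous.
  have as1 : a - 1 < s by rewrite ltrBlDr ltr_pwDr.
  have dI := is_derive_Rintegral cfij as1.
  have dC := is_derive_cst (\int[lebesgue_measure]_(t in `[a - 1, b]) f t i j) s 1.
  have := is_deriveB dC dI; rewrite sub0r.
  rewrite (_ : (fun y => F y i j) =
    (cst (\int[lebesgue_measure]_(t in `[a - 1, b]) f t i j)
     - (fun y => \int[lebesgue_measure]_(t in `[a - 1, y]) f t i j))).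
    by rewrite mxE.
  by apply/funext => y; rewrite mxE.
apply/is_derive_inP => e e0.
have := dF e e0.
apply: filterS => y yF yab.
by rewrite (FE s) ?in_itv/= ?as_// (FE y)// yF.
Qed.

(** Norm estimates for integrals are drawn from the mean value inequality with majorant [M x], so
    that no integral of a norm is formed. *)
Lemma backward_bound a b f df M s :
  (forall x, a <= x <= b -> is_derive_in `[a, b] f x (df x)) -> f b = 0 ->
  (forall x, a <= x <= b -> `|df x| <= M) -> a <= s <= b ->
  `|f s| <= M * (b - s).
Proof.
move=> fd fb dfM /andP[as_ sb].
have sub x : s <= x <= b -> a <= x <= b.
  by move=> /andP[sx ->]; rewrite (le_trans as_).
have := @mean_value_le R m n f df (fun x => M * x) (fun=> M) s b sb.
rewrite fb sub0r normrN mulrBr; apply.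
- move=> x xsb; apply: is_derive_in_sub (fd x (sub x xsb)).
  move=> y /=; rewrite !in_itv/=; exact: sub.
- move=> x _; have h : is_derive x 1 (M *: id) (M *: (1 : R)) by exact: is_deriveZ.
  exact: (is_derive_eq h (mulr1 M)).
- by move=> x xsb; exact/dfM/sub.
Qed.

Lemma backward_integral_dist a b f g M s : continuous f -> continuous g ->
  a <= b -> 0 <= M -> (forall x, a <= x <= b -> `|f x - g x| <= M) ->
  `|backward_integral a b f s - backward_integral a b g s| <= M * (b - a).
Proof.
move=> cf cg ab M0 fg; rewrite -backward_integral_clamp//.
rewrite -[backward_integral a b g s]backward_integral_clamp//.
have sab := clamp_itv s ab.
apply: le_trans (_ : M * (b - clamp a b s) <= _); last first.
  by rewrite ler_wpM2l// lerB//; case/andP: sab.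
apply: (@backward_bound a b (fun s => backward_integral a b f s -
  backward_integral a b g s) (fun x => - f x - - g x)) => //.
- by move=> x xab; apply: is_derive_inB; exact: is_derive_backward_integral.
- by rewrite !backward_integral_right// subrr.
- by move=> x xab; rewrite opprK addrC distrC fg.
Qed.

Lemma backward_integral_norm a b f M s : continuous f ->
  a <= b -> 0 <= M -> (forall x, a <= x <= b -> `|f x| <= M) ->
  `|backward_integral a b f s| <= M * (b - a).
Proof.
move=> cf ab M0 fM; rewrite -backward_integral_clamp//.
have sab := clamp_itv s ab.
apply: le_trans (_ : M * (b - clamp a b s) <= _); last first.
  by rewrite ler_wpM2l// lerB//; case/andP: sab.
apply: (@backward_bound a b _ (fun x => - f x)) => //.
- by move=> x xab; exact: is_derive_backward_integral.
- by rewrite backward_integral_right.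
- by move=> x xab; rewrite normrN fM.
Qed.

Lemma backward_integral_continuous a b f :
  continuous f -> a <= b -> continuous (backward_integral a b f).
Proof.
move=> cf ab.
have -> : backward_integral a b f = backward_integral a b f \o clamp a b.
  by apply/funext => s /=; rewrite backward_integral_clamp.
apply: (@continuous_comp_within _ _ _ `[a, b]).
- apply: (@is_derive_in_continuous _ _ _ _ _ (fun x => - f x)) => x.
  by rewrite /= in_itv/=; exact: is_derive_backward_integral.
- exact: continuous_clamp.
- by move=> x; rewrite /= in_itv/= clamp_itv.
Qed.

Lemma continuous_section (T U V : topologicalType) (F : T * U -> V) t :
  continuous F -> continuous (fun u => F (t, u)).
Proof.
move=> cF u; apply: (@continuous_comp _ _ _ (fun u => (t, u)) F).
  by apply: cvg_pair => /=; [exact: cvg_cst|exact: cvg_id].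
exact: cF.
Qed.

(** Tube argument: by compactness of [[a, b]], for [t] near [t0] the integrands are uniformly close
    in [r]; what remains is continuity in [s] at the fixed [t0]. *)
Lemma backward_integral_continuous2 (T : topologicalType) a b
    (F : T * R -> 'M[R]_(m, n)) : continuous F -> a <= b ->
  continuous (fun p : T * R => backward_integral a b (fun r => F (p.1, r)) p.2).
Proof.
move=> cF ab -[t0 s0]; apply/cvgrPdist_le => e e0 /=.
have cFt t : continuous (fun r => F (t, r)) by exact: continuous_section.
pose d := e / 2 / (b - a + 1).
have ba0 : 0 < b - a + 1 by rewrite ltr_wpDl// subr_ge0.
have e20 : 0 < e / 2 by rewrite divr_gt0.
have d0 : 0 < d by rewrite divr_gt0.
have dab : d * (b - a) <= e / 2.
  by rewrite /d mulrAC ler_pdivrMr// ler_wpM2l ?(ltW e20)// lerDl.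
have near_t : \forall t \near t0,
    `[a, b] `<=` (fun r => `|F (t0, r) - F (t, r)| <= d).
  have /compact_near_coveringP := @segment_compact R a b.
  apply => r _.
  have d20 : 0 < d / 2 by rewrite divr_gt0.
  have /cvgrPdist_le/(_ _ d20) Fr := cF (t0, r).
  case: Fr => -[U V] /= [Ut0 Vr] UV.
  exists (V, U) => //= -[r' t] /= [Vr' Ut].
  have Ft := UV (t, r') (conj Ut Vr').
  have Ft0 := UV (t0, r') (conj (nbhs_singleton Ut0) Vr').
  rewrite (_ : _ - _ = (F (t0, r) - F (t, r')) - (F (t0, r) - F (t0, r'))); last first.
    by rewrite opprB [RHS]addrC addrA subrK.
  apply: le_trans (ler_normB _ _) _.
  by rewrite (splitr d) lerD.
have /cvgrPdist_le/(_ _ e20) near_s :=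
  backward_integral_continuous (cFt t0) ab (x:=s0).
exists ([set t | `[a, b] `<=` (fun r => `|F (t0, r) - F (t, r)| <= d)],
  [set s | `|backward_integral a b (fun r => F (t0, r)) s0 -
              backward_integral a b (fun r => F (t0, r)) s| <= e / 2]) => //=.
move=> -[t s] /= [tF sF].
rewrite (_ : _ - _ = (backward_integral a b (fun r => F (t0, r)) s0 -
   backward_integral a b (fun r => F (t0, r)) s) +
   (backward_integral a b (fun r => F (t0, r)) s -
   backward_integral a b (fun r => F (t, r)) s)); last by rewrite addrA subrK.
apply: le_trans (ler_normD _ _) _; rewrite (splitr e) lerD//.
apply: le_trans dab; apply: backward_integral_dist => //; first exact: ltW.
Qed.

End Primitive.

(** * Contractions and the Lyapunov equation *)

Section FixedPoint.
Context {R : realType}.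

(** Here [r k] is the tail of the geometric series, so [u - r] increases, [u + r] decreases, and the
    supremum of the former lies in all the nested intervals. This yields the limit together with its
    rate. *)
Lemma geometric_limit (u : nat -> R) c : 0 <= c ->
  (forall k, `|u k.+1 - u k| <= c * 2^-1 ^+ k) ->
  exists l, forall k, `|u k - l| <= c * 2 * 2^-1 ^+ k.
Proof.
move=> c0 uc; pose r k := c * 2 * 2^-1 ^+ k.
have rS k : r k.+1 = r k - c * 2^-1 ^+ k.
  by rewrite /r exprS; field.
have r0 k : 0 <= r k by rewrite /r !mulr_ge0// exprn_ge0.
pose a k := u k - r k; pose b k := u k + r k.
have am : {homo a : i j / (i <= j)%N >-> i <= j}.
  apply: homo_leq => [//|y x z|k]; first exact: le_trans.
  have := uc k; rewrite ler_norml => /andP[h _]; rewrite /a rS; lra.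
have bm : {homo b : i j / (i <= j)%N >-> j <= i}.
  apply: homo_leq => [//|y x z xy yz|k]; first exact: le_trans yz xy.
  have := uc k; rewrite ler_norml => /andP[_ h]; rewrite /b rS; lra.
have ab i j : a i <= b j.
  apply: le_trans (am _ _ (leq_maxl i j)) _.
  apply: le_trans (bm _ _ (leq_maxr i j)).
  by rewrite /a /b; have := r0 (maxn i j); lra.
have sa : has_sup (range a).
  by split; [exists (a 0%N), 0%N | exists (b 0%N) => _ [k _ <-]].
exists (sup (range a)) => k; rewrite -/(r k).
have h1 : a k <= sup (range a) by apply: sup_ubound; [case: sa|exists k].
have h2 : sup (range a) <= b k by apply: sup_le_ub => [|_ [j _ <-]//]; case: sa.
by rewrite ler_norml; rewrite /a /b in h1 h2; apply/andP; split; lra.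
Qed.

Lemma half_exp_small (c e : R) : 0 <= c -> 0 < e ->
  exists k, c * 2^-1 ^+ k <= e.
Proof.
move=> c0 e0; have := @cvg_expr R 2^-1; rewrite gtr0_norm// => h.
have {h}/cvgrPdist_le h : GRing.exp (2^-1 : R) @ \oo --> 0 by apply: h; lra.
have ec : 0 < e / (c + 1) by rewrite divr_gt0// ltr_wpDl.
have [k _ /(_ k (leqnn k))] := h _ ec.
rewrite /= sub0r normrN ger0_norm ?exprn_ge0// => hk; exists k.
apply: le_trans (ler_wpM2l c0 hk) _.
by rewrite mulrCA ger_pMr// ler_pdivrMr ?ltr_wpDl// mul1r lerDl.
Qed.

(** Banach's theorem in the uniform distance, without forming a function space: the iterates
    converge entry by entry at a rate uniform in [z], and closure of [U] under uniform approximation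
    captures the limit. *)
Lemma contraction_fixpoint (Z : Type) m n (U : set (Z -> 'M[R]_(m, n)))
    (F : (Z -> 'M[R]_(m, n)) -> Z -> 'M[R]_(m, n)) f0 c :
  U f0 -> (forall f, U f -> U (F f)) ->
  (forall f, (forall e, 0 < e -> exists2 g, U g & forall z, `|f z - g z| <= e) ->
     U f) ->
  0 <= c -> (forall z, `|F f0 z - f0 z| <= c) ->
  (forall f g d, 0 <= d -> U f -> U g -> (forall z, `|f z - g z| <= d) ->
     forall z, `|F f z - F g z| <= d / 2) ->
  exists2 f, U f & forall z, F f z = f z.
Proof.
move=> U0 UF Ucl c0 F0 Fc.
pose u k := iter k F f0.
have Uu k : U (u k) by elim: k => //= k; exact: UF.
have uS k z : `|u k.+1 z - u k z| <= c * 2^-1 ^+ k.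
  elim: k z => [|k IH] z; first by rewrite expr0 mulr1 F0.
  rewrite exprSr mulrA; apply: (Fc _ _ _ _ (Uu k.+1) (Uu k)) => //.
  by rewrite mulr_ge0// exprn_ge0.
have ulim : forall z i j, exists l, forall k,
    `|u k z i j - l| <= c * 2 * 2^-1 ^+ k.
  move=> z i j; apply: geometric_limit => // k; apply: le_trans (uS k z).
  by apply: le_trans (mx_norm_ge_entry _ i j); rewrite !mxE.
pose f z : 'M[R]_(m, n) := \matrix_(i, j) sval (cid (ulim z i j)).
have fu k z : `|f z - u k z| <= c * 2 * 2^-1 ^+ k.
  apply: mx_norm_le => [|i j]; first by rewrite !mulr_ge0// exprn_ge0.
  by rewrite !mxE distrC; exact: (svalP (cid (ulim z i j))).
have Uf : U f.
  apply: Ucl => e e0; have [k ke] := half_exp_small (mulr_ge0 c0 (ler0n _ 2)) e0.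
  by exists (u k) => // z; apply: le_trans (fu k z) ke.
exists f => // z; apply/eqP; rewrite -subr_eq0 -normr_eq0 eq_le normr_ge0 andbT.
apply/ler_addgt0Pr => e e0; rewrite add0r.
have [k ke] := half_exp_small (mulr_ge0 c0 (ler0n _ 2)) e0.
have -> : F f z - f z = (F f z - F (u k) z) - (f z - u k.+1 z).
  by rewrite /= opprB addrC addrA subrK addrC.
apply: le_trans (ler_normB _ _) _.
apply: le_trans (lerD (Fc _ _ _ _ Uf (Uu k) (fu k) z) (fu k.+1 z)) _.
  by rewrite !mulr_ge0// exprn_ge0.
by apply: le_trans ke; rewrite exprS le_eqVlt; apply/orP; left; apply/eqP; field.
Qed.

End FixedPoint.

(** * Positivity for the linear Lyapunov equation *)

Section Lyapunov.
Context {R : realType} {n : nat}.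

Lemma sqnorm_mul_le p q (A : 'M[R]_(p, q)) L x : 0 <= L -> `|A| <= L ->
  sqnorm (A *m x) <= q%:R * p%:R * L ^+ 2 * sqnorm x.
Proof.
move=> L0 AL.
have -> : sqnorm (A *m x) = qform (A^T *m A) x.
  by rewrite /sqnorm /qform trmx_mul !mulmxA.
apply: le_trans (ler_norm _) _; apply: le_trans (qform_norm _ _) _.
rewrite ler_wpM2r ?sqnorm_ge0// -mulrA ler_wpM2l//.
apply: le_trans (mx_norm_mul _ _) _; rewrite mx_norm_tr -mulrA ler_wpM2l//.
by rewrite expr2 ler_pM.
Qed.

Lemma qform_euler (P A : 'M[R]_n) h x :
  qform P ((1%:M + h *: A) *m x) =
  qform P x + h * qform (P *m A + A^T *m P) x + h ^+ 2 * qform P (A *m x).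
Proof.
rewrite -!qform_congr -!qformZ -!qformD; congr (qform _ x).
have -> : (1%:M + h *: A)^T = 1%:M + h *: A^T.
  by rewrite [LHS]linearD/= trmx1 [(h *: A)^T]linearZ.
rewrite mulmxDl mul1mx mulmxDr mulmx1 mulmxDl -!scalemxAl -!scalemxAr scalerA.
by rewrite scalerDr -expr2 !addrA; congr (_ + _); rewrite addrAC.
Qed.

(* With [w s = exp (lam * (T - s))] one shows [P s + e w(s) I >= 0] for every
   [e > 0], by continuity going down from [T]: up to [O(h^2)], the backward step
   [P + h (P A + A^T P)] is the congruence [(I + h A)^T P (I + h A)], and the growth
   of [w] absorbs the error. *)
Lemma lyapunov_psd (P A C S : R -> 'M[R]_n) (t T L : R) : 0 <= L ->
  (forall s, t <= s <= T -> is_derive_in `[t, T] P s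
     (- (P s *m A s + (A s)^T *m P s + (C s)^T *m P s *m C s + S s))) ->
  (forall s, t <= s <= T -> [/\ `|A s| <= L, `|C s| <= L &
     forall x, 0 <= qform (S s) x]) ->
  (forall x, 0 <= qform (P T) x) ->
  forall s, t <= s <= T -> forall x, 0 <= qform (P s) x.
Proof.
move=> L0 dP bounds PT.
(* In one backward step of length [h], the terms in [A] and [C] lose at most [2 n L + a] times
   [e w h |x|^2] to first order. The extra 1 leaves a surplus [e w h |x|^2] for the remainders. *)
pose a := n%:R * n%:R * L ^+ 2 : R; pose lam := 2 * n%:R * L + a + 1.
have a0 : 0 <= a by rewrite /a !mulr_ge0// sqr_ge0.
have lam0 : 0 <= lam by rewrite /lam !addr_ge0// !mulr_ge0.
pose w s := expR (lam * (T - s)).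
have w0 s : 0 < w s by exact: expR_gt0.
have w1 s : s <= T -> 1 <= w s.
  by move=> sT; rewrite /w -expR0 ler_expR mulr_ge0// subr_ge0.
have wd s r : s <= r -> w r <= w s.
  by move=> sr; rewrite /w ler_expR ler_wpM2l// lerB.
have wS s h : w s * (1 + lam * h) <= w (s - h).
  have -> : w (s - h) = w s * expR (lam * h).
    by rewrite /w -expRD; congr expR; ring.
  by rewrite ler_wpM2l ?(ltW (w0 _))// expR_ge1Dx.
suff main e : 0 < e -> forall s, t <= s <= T -> forall x,
    - (e * w s * sqnorm x) <= qform (P s) x.
  move=> s sT x; apply/ler_addgt0Pr => e e0.
  have d0 : 0 < w s * sqnorm x + 1 by rewrite ltr_wpDl// mulr_ge0 ?sqnorm_ge0// ltW.
  have := main (e / (w s * sqnorm x + 1)) (divr_gt0 e0 d0) s sT x.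
  rewrite -subr_ge0 opprK => h; apply: le_trans h _; rewrite lerD2l -mulrA.
  by rewrite mulrAC ler_pdivrMr// mulrDr mulr1 lerDl ltW.
move=> e0.
pose good s := forall x, - (e * w s * sqnorm x) <= qform (P s) x.
suff : ~ exists s, t <= s <= T /\ ~ good s.
  by move=> h s sT; apply: contrapT => ng; apply: h; exists s.
move=> [b0 [b0T b0g]].
(* All times after the supremum [s0] of the bad set are good, hence so is [s0] by continuity, and
   then a left neighbourhood of [s0], which contradicts the choice of [s0]. *)
pose B := [set s | t <= s <= T /\ ~ good s].
have supB : has_sup B by split; [exists b0|exists T => s [/andP[]]].
pose s0 := sup B.
have b0s0 : b0 <= s0 by apply: sup_ubound; [case: supB|].
have s0T : t <= s0 <= T.
  case/andP: (b0T) => tb bT; rewrite (le_trans tb b0s0)/=.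
  by apply: sup_le_ub => [|s [/andP[_ sT] _]//]; exists b0.
have after r : s0 < r -> r <= T -> good r.
  move=> s0r rT; apply: contrapT => ng; suff : r <= s0 by rewrite leNgt s0r.
  apply: sup_ubound; first by case: supB.
  by split=> //; case/andP: s0T => ts _; rewrite (le_trans ts (ltW s0r)).
have goods0 : good s0.
  case/andP: (s0T) => ts0; rewrite le_eqVlt => /predU1P[->|s0T'].
    move=> x; apply: le_trans (PT x); rewrite oppr_le0.
    by rewrite !mulr_ge0 ?sqnorm_ge0// ltW.
  move=> x; apply/ler_addgt0Pr => d d0.
  have cP : {within `[t, T], continuous P}.
    by apply: is_derive_in_continuous => s; rewrite /= in_itv/=; exact: dP.
  have d'0 : 0 < d / (n%:R * sqnorm x + 1).
    by rewrite divr_gt0// ltr_wpDl// mulr_ge0 ?sqnorm_ge0.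
  have /subspace_continuousP/(_ s0) := cP; rewrite /= in_itv/= => /(_ s0T).
  move=> /cvgrPdist_le/(_ _ d'0) Pnear.
  have {}Pnear : \forall r \near s0, r \in `[t, T] ->
      `|P s0 - P r| <= d / (n%:R * sqnorm x + 1).
    exact: Pnear.
  have [r [s0r rT Pr]] : exists r, [/\ s0 < r, r <= T &
      r \in `[t, T] -> `|P s0 - P r| <= d / (n%:R * sqnorm x + 1)].
    have : \forall r \near s0^'+, [/\ s0 < r, r <= T &
      r \in `[t, T] -> `|P s0 - P r| <= d / (n%:R * sqnorm x + 1)].
      near=> r; split.
      - by near: r; exact: nbhs_right_gt.
      - by near: r; exact: nbhs_right_le.
      - by near: r; exact: cvg_within Pnear.
    exact: filter_ex.
  have rI : r \in `[t, T] by rewrite in_itv/= rT (le_trans ts0 (ltW s0r)).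
  have h1 := after r s0r rT x.
  have h2 := qform_norm (P s0 - P r) x.
  have h3 : n%:R * `|P s0 - P r| * sqnorm x <= d.
    apply: le_trans (_ : n%:R * (d / (n%:R * sqnorm x + 1)) * sqnorm x <= _).
      by rewrite ler_wpM2r ?sqnorm_ge0// ler_wpM2l// Pr.
    rewrite mulrAC mulrCA ger_pMr// ler_pdivrMr; last first.
      by rewrite ltr_wpDl// mulr_ge0 ?sqnorm_ge0.
    by rewrite mul1r lerDl.
  have h4 : e * w r * sqnorm x <= e * w s0 * sqnorm x.
    by rewrite ler_wpM2r ?sqnorm_ge0// ler_wpM2l// ?wd ?(ltW s0r) ?(ltW e0).
  move: h2; rewrite qformB ler_norml => /andP[h2 _]; lra.
have [AL CL S0] := bounds s0 s0T.
have /is_derive_inP dP0 := dP s0 s0T.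
(* Since [w >= 1], the surplus is at least [e h |x|^2]. Half of it pays for the differentiability
   error through [eta], the other half for the terms in [h^2], whose coefficients are collected in
   [q]. *)
pose eta := e / 2 / (n%:R + 1).
have n1 : 0 < n%:R + 1 :> R by rewrite ltr_wpDl.
have eta0 : 0 < eta by rewrite !divr_gt0.
pose q := a * (e * w s0 + n%:R * `|P s0|).
have q0 : 0 <= q by rewrite mulr_ge0// addr_ge0// mulr_ge0// ltW.
have d0 : 0 < e / 2 / (q + 1) by rewrite !divr_gt0// ltr_wpDl.
have near_good : \forall s \near s0, t <= s -> s <= s0 -> good s.
  have := nbhsx_ballx s0 _ d0; rewrite -nearE; move: (dP0 _ eta0).
  apply: filterS2 => s sP sd ts ss0 x.
  have sI : (`[t, T]%classic : set R) s.
    by rewrite /= in_itv/= ts; case/andP: s0T => _; exact: le_trans.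
  move: sP => /(_ sI); set h := s0 - s.
  have h0 : 0 <= h by rewrite subr_ge0.
  have -> : s - s0 = - h by rewrite opprB.
  rewrite normrN (ger0_norm h0) scalerN scaleNr opprK => sP.
  have hd : h <= e / 2 / (q + 1).
    by apply: le_trans (ler_norm _) _; move: sd; rewrite -ball_normE => /ltW.
  have hq : h * q <= e / 2.
    apply: le_trans (ler_wpM2r q0 hd) _.
    rewrite mulrAC ler_pdivrMr ?ltr_wpDl// ler_wpM2l ?lerDl//.
    by rewrite divr_ge0// ltW.
  set X := P s - P s0 - _ in sP.
  have sE : qform (P s) x = qform (P s0) ((1%:M + h *: A s0) *m x)
      - h ^+ 2 * qform (P s0) (A s0 *m x) + h * qform (P s0) (C s0 *m x)
      + h * qform (S s0) x + qform X x.
    rewrite qform_euler -(qform_congr _ (C s0)) /X !qformB qformZ !qformD.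
    by ring.
  have hX := qform_norm X x.
  have sx := sqnorm_ge0 x.
  have hX' : n%:R * `|X| * sqnorm x <= e / 2 * h * sqnorm x.
    rewrite ler_wpM2r//; apply: le_trans (ler_wpM2l _ sP) _ => //.
    rewrite mulrA ler_wpM2r// /eta mulrCA ger_pMr ?divr_gt0//.
    by rewrite ler_pdivrMr// mul1r lerDl.
  have hA : sqnorm (A s0 *m x) <= a * sqnorm x by exact: sqnorm_mul_le.
  have hC : sqnorm (C s0 *m x) <= a * sqnorm x by exact: sqnorm_mul_le.
  have hPA := qform_norm (P s0) (A s0 *m x).
  have hPC := goods0 (C s0 *m x).
  have hz := goods0 ((1%:M + h *: A s0) *m x).
  have hzn : sqnorm ((1%:M + h *: A s0) *m x) <=
      sqnorm x + h * (2 * n%:R * L * sqnorm x) + h ^+ 2 * (a * sqnorm x).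
    have qn y : sqnorm y = qform 1%:M y by rewrite qform_scalar mul1r.
    rewrite qn qform_euler -!qn mulmx1 mul1mx qformD qform_tr.
    apply: lerD; last by rewrite ler_wpM2l ?sqr_ge0.
    rewrite lerD2l ler_wpM2l//.
    have : qform (A s0) x <= n%:R * L * sqnorm x.
      apply: le_trans (ler_norm _) _; apply: le_trans (qform_norm _ _) _.
      by rewrite ler_wpM2r// ler_wpM2l.
    lra.
  have hS := S0 x.
  have ews : 0 < e * w s0 by rewrite mulr_gt0.
  have wE : e * (w s0 * (1 + lam * h)) * sqnorm x <= e * w s * sqnorm x.
    rewrite ler_wpM2r// ler_wpM2l ?(ltW e0)//.
    by apply: le_trans (wS _ _) _; rewrite /h opprB addrC subrK.
  have k1 : - (e * w s0 * (sqnorm x + h * (2 * n%:R * L * sqnorm x)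
      + h ^+ 2 * (a * sqnorm x))) <= qform (P s0) ((1%:M + h *: A s0) *m x).
    by apply: le_trans hz; rewrite lerN2 ler_wpM2l// ltW.
  have k2 : h * - (e * w s0 * (a * sqnorm x)) <= h * qform (P s0) (C s0 *m x).
    by rewrite ler_wpM2l//; apply: le_trans hPC; rewrite lerN2 ler_wpM2l// ltW.
  have k3 : h ^+ 2 * qform (P s0) (A s0 *m x) <=
      h ^+ 2 * (n%:R * `|P s0| * (a * sqnorm x)).
    rewrite ler_wpM2l ?sqr_ge0//; apply: le_trans (ler_norm _) _.
    by apply: le_trans hPA _; rewrite ler_wpM2l ?mulr_ge0.
  have k4 : h * q * (h * sqnorm x) <= e / 2 * (h * sqnorm x).
    by rewrite ler_wpM2r// mulr_ge0.
  have k5 : e * 1 * (h * sqnorm x) <= e * w s0 * (h * sqnorm x).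
    rewrite ler_wpM2r ?mulr_ge0// ler_wpM2l ?(ltW e0)// w1//.
    by case/andP: s0T.
  have k6 : 0 <= h * qform (S s0) x by rewrite mulr_ge0.
  move: hX; rewrite ler_norml => /andP[hX _].
  rewrite sE; apply: le_trans (_ : - (e * (w s0 * (1 + lam * h)) * sqnorm x) <= _).
    by rewrite lerN2.
  rewrite /lam; rewrite /q in k4.
  set W := w s0 in k1 k2 k3 k4 k5 wE *; set sq := sqnorm x in k1 k2 k3 k4 k5 hX hX' *.
  set NP := `|P s0| in k3 k4; lra.
have [d /= dpos dball] := (nbhs_ballP _ _).1 near_good.
have [b Bb s0b] := sup_adherent dpos supB.
have bs0 : b <= s0 by apply: sup_ubound; [case: supB|].
case: (Bb) => /andP[tb _]; apply; apply: dball => //.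
by rewrite -ball_normE /= ger0_norm ?subr_ge0// ltrBlDr -ltrBlDl.
Unshelve. all: by end_near. Qed.

End Lyapunov.

(** * Uniqueness on the triangle *)

Section Gronwall.
Context {R : realType} {m n : nat}.

Lemma is_derive_expR_affine (lam b c x : R) :
  is_derive x 1 (fun y => - (c * expR (lam * (b - y))))
    (c * lam * expR (lam * (b - x))).
Proof.
have h : is_derive x 1 (fun y => lam * (b - y)) (- lam).
  apply/is_derive1_caratheodory; exists (cst (- lam)); split=> //.
    by move=> z /=; ring.
  exact: cst_continuous.
have he : is_derive x 1 (expR \o (fun y => lam * (b - y)))
    (expR (lam * (b - x)) * - lam).
  exact: is_derive1_comp.
have hc : is_derive x 1 (- (c *: (expR \o (fun y => lam * (b - y)))))
  (- (c *: (expR (lam * (b - x)) * - lam))).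
  by apply: is_deriveN; apply: is_deriveZ.
by apply: is_derive_eq hc _; rewrite [c *: _]mulrA; ring.
Qed.

(* Iterating the integral inequality halves the bound
   [K 2^-k exp (lam * (b - s))] each time. *)
Lemma triangle_gronwall (E dE : R -> R -> 'M[R]_(m, n)) (a b L K : R) :
  0 <= L -> 0 <= K ->
  (forall t s, a <= t -> t <= s -> s <= b ->
     [/\ is_derive_in `[t, b] (E t) s (dE t s),
         `|dE t s| <= L * (`|E t s| + `|E s s|) & `|E t s| <= K]) ->
  (forall t, a <= t -> t <= b -> E t b = 0) ->
  forall t s, a <= t -> t <= s -> s <= b -> E t s = 0.
Proof.
move=> L0 K0 EL Eb.
(* Two error terms, each under the inductive bound, integrate to the factor [2 * L / lam <= 1/2];
   the [+ 1] covers [L = 0]. *)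
pose lam := 4 * L + 1; have lam0 : 0 < lam by rewrite /lam; lra.
pose c k := K * 2^-1 ^+ k.
have c0 k : 0 <= c k by rewrite /c mulr_ge0// exprn_ge0.
(* The induction runs over all [t] at once, because the diagonal term [E s s] belongs to another
   section of the triangle. *)
have bound k : forall t s, a <= t -> t <= s -> s <= b ->
    `|E t s| <= c k * expR (lam * (b - s)).
  elim: k => [|k IH] t s at_ ts sb.
    have [_ _ EK] := EL t s at_ ts sb; apply: le_trans EK _.
    rewrite /c expr0 mulr1 ler_peMr// -expR0 ler_expR.
    by rewrite mulr_ge0 ?(ltW lam0)// subr_ge0.
  have sub x : s <= x <= b -> [/\ t <= x, x <= b & a <= x].
    move=> /andP[sx xb]; have tx := le_trans ts sx.
    by split=> //; exact: le_trans tx.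
  have := @mean_value_le R m n (E t) (dE t)
    (fun x => - (c k * 2 * L / lam * expR (lam * (b - x))))
    (fun x => c k * 2 * L / lam * lam * expR (lam * (b - x))) s b sb.
  rewrite Eb ?(le_trans ts sb)// sub0r normrN subrr mulr0 expR0.
  move=> /(_ _ _ _)/le_trans; apply.
  - move=> x /sub[tx xb ax]; have [dx _ _] := EL t x at_ tx xb.
    apply: is_derive_in_sub dx => y /=; rewrite !in_itv/= => /andP[sy ->].
    by rewrite (le_trans ts).
  - by move=> x _; exact: is_derive_expR_affine.
  - move=> x /sub[tx xb ax]; have [_ dx _] := EL t x at_ tx xb.
    apply: le_trans dx _; rewrite divfK ?gt_eqF//.
    rewrite [leRHS](_ : _ =
      L * (c k * expR (lam * (b - x)) + c k * expR (lam * (b - x)))).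
      by rewrite ler_wpM2l// lerD ?IH.
    by ring.
  have h : 2 * L / lam <= 2^-1.
    by rewrite ler_pdivrMr// /lam; lra.
  rewrite opprK /c exprSr -/(c k); set X := expR _.
  have X0 : 0 < X by exact: expR_gt0.
  have h2 : c k * X * (2 * L / lam) <= c k * X * 2^-1.
    by rewrite ler_wpM2l// mulr_ge0 ?(ltW X0).
  have h3 : 0 <= c k * 2 * L / lam * 1.
    by rewrite mulr1 divr_ge0 ?(ltW lam0)// !mulr_ge0.
  rewrite /c in h2 h3 *; lra.
move=> t s at_ ts sb; apply/eqP; rewrite -normr_eq0 eq_le normr_ge0 andbT.
apply/ler_addgt0Pr => e e0; rewrite add0r.
have [k hk] := half_exp_small (mulr_ge0 K0 (expR_ge0 (lam * (b - s)))) e0.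
by apply: le_trans (bound k t s at_ ts sb) _; rewrite /c mulrAC.
Qed.

End Gronwall.

(** * Bounds on compact sets *)

Section Bounded.
Context {R : realType}.

Lemma within_compact_bounded (T : topologicalType) m n (A : set T)
    (f : T -> 'M[R]_(m, n)) :
  {within A, continuous f} -> compact A ->
  exists2 K : R, 0 <= K & forall x, A x -> `|f x| <= K.
Proof.
move=> cf cA; have [M [Mr fM]] := compact_bounded (continuous_compact cf cA).
exists (`|M| + 1) => [|x Ax]; first by rewrite addr_ge0.
by apply: fM; [rewrite ltr_pwDr// ler_norm|exists x].
Qed.

(** The triangle is the image of the square under the continuous retraction sending [(t, s)] to
    [(min t s, s)]. *)
Lemma compact_triangle (a b : R) : a <= b -> compact (triangle a b).
Proof.
move=> ab.
pose c (p : R * R) := (Num.min (clamp a b p.1) (clamp a b p.2), clamp a b p.2).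
have -> : triangle a b = c @` (`[a, b] `*` `[a, b]).
  apply/seteqP; split=> [[t s] [/= at_ [ts sb]]|_ [[t s] /= _ <-]].
    have tb := le_trans ts sb; have as_ := le_trans at_ ts.
    exists (t, s); first by split; rewrite /= in_itv/= ?at_ ?as_ ?tb ?sb.
    by rewrite /c/= !clamp_id// min_l.
  have /andP[h1 h2] := clamp_itv t ab; have /andP[h3 h4] := clamp_itv s ab.
  by split; rewrite /= ?le_min ?h1 ?h3//; split=> //; rewrite ge_min lexx orbT.
apply: continuous_compact; last first.
  by apply: compact_setX; exact: segment_compact.
apply: continuous_subspaceT => p.
have c1 : continuous (fun p : R * R => clamp a b p.1).
  move=> q; apply: (@continuous_comp _ _ _ fst (clamp a b)).
    exact: cvg_fst.
  exact: continuous_clamp.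
have c2 : continuous (fun p : R * R => clamp a b p.2).
  move=> q; apply: (@continuous_comp _ _ _ snd (clamp a b)).
    exact: cvg_snd.
  exact: continuous_clamp.
exact: (cvg_pair (@continuous_min _ _ _ _ _ (c1 p) (c2 p)) (c2 p)).
Qed.

End Bounded.

(** * Local solvability *)

Section Riccati.
Context {R : realType} {n m : nat}.

Lemma symmetricmxP p (M : 'M[R]_p) : M \is symmetricmx <-> M^T = M.
Proof.
rewrite is_hermitianmxE expr0 scale1r map_mx_id; split=> [/eqP{2}->//|->].
exact: eqxx.
Qed.

(** These stand for the clamped coefficients, hence the global continuity and bounds. Coercivity of
    [Rw] is assumed on the diagonal; positivity of [Q] and [Rw] for [t <= s] is passed to the lemmas
    that use it, as it may fail off the triangle. *)
Variables (A C : R -> 'M[R]_n) (B D : R -> 'M[R]_(n, m)).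
Variables (G : R -> 'M[R]_n) (Q : R -> R -> 'M[R]_n) (Rw : R -> R -> 'M[R]_m).
Variables (T K delta : R).
Hypotheses (K_ge0 : 0 <= K) (delta_gt0 : 0 < delta).
Hypotheses (A_cont : continuous A) (B_cont : continuous B)
  (C_cont : continuous C) (D_cont : continuous D) (G_cont : continuous G)
  (Q_cont : continuous (fun p : R * R => Q p.1 p.2))
  (Rw_cont : continuous (fun p : R * R => Rw p.1 p.2)).
Hypotheses (A_le : forall s, `|A s| <= K) (B_le : forall s, `|B s| <= K)
  (C_le : forall s, `|C s| <= K) (D_le : forall s, `|D s| <= K)
  (Q_le : forall t s, `|Q t s| <= K) (Rw_le : forall t s, `|Rw t s| <= K).
Hypotheses (G_sym : forall t, (G t)^T = G t)
  (Q_sym : forall t s, (Q t s)^T = Q t s)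
  (Rw_sym : forall t s, (Rw t s)^T = Rw t s).
Hypotheses (Rw_coercive : forall s, coercive delta (Rw s s))
  (G_psd : forall t x, 0 <= qform (G t) x).

Definition datum (t s : R) (X Y : 'M[R]_n) : @data R n m :=
  Data (A s) (B s) (C s) (D s) (Q t s) (Rw t s) (Rw s s) X Y.

(** Seven coefficient matrices are bounded by [K], two values of the unknown by [M]. *)
Lemma datum_dom t s X Y M d : `|X| <= M -> `|Y| <= M ->
  coercive d (Rw s s + (D s)^T *m Y *m D s) ->
  data_dom (7 * K + 2 * M) d (datum t s X Y).
Proof.
move=> XM YM cY; split=> //; rewrite /dnorm /=.
have := A_le s; have := B_le s; have := C_le s; have := D_le s.
have := Q_le t s; have := Rw_le t s; have := Rw_le s s; lra.
Qed.

Lemma ddist_datum t s X Y X' Y' :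
  ddist (datum t s X Y) (datum t s X' Y') = `|X - X'| + `|Y - Y'|.
Proof. by rewrite /ddist /= !subrr !normr0 !add0r. Qed.

Lemma near_ddist_datum (P : R * R -> 'M[R]_n) t s e : continuous P -> 0 < e ->
  \forall p \near (t, s),
    ddist (datum t s (P (t, s)) (P (s, s)))
      (datum p.1 p.2 (P p) (P (p.2, p.2))) <= e.
Proof.
(* [ddist] has nine summands. *)
move=> cP e0; pose d := e / 9; have d0 : 0 < d by rewrite divr_gt0.
have fst_near p q (F : R -> 'M[R]_(p, q)) : continuous F ->
    \forall r \near (t, s), `|F s - F r.2| <= d.
  move=> cF; have cF2 : F r.2 @[r --> (t, s)] --> F s.
    apply: (@continuous_comp _ _ _ snd F (t, s)); first exact: cvg_snd.
    exact: cF.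
  exact: (cvgrPdist_le _ _).1 cF2 d d0.
have two_near p q (F : R * R -> 'M[R]_(p, q)) : continuous F ->
    \forall r \near (t, s), `|F (t, s) - F r| <= d.
  by move=> cF; exact: (cvgrPdist_le _ _).1 (cF (t, s)) d d0.
have diag_cont p q (F : R * R -> 'M[R]_(p, q)) : continuous F ->
    continuous (fun r => F (r, r)).
  move=> cF r; apply: (@continuous_comp _ _ _ (fun r => (r, r)) F).
    exact: (cvg_pair (@cvg_id _ (nbhs r)) (@cvg_id _ (nbhs r))).
  exact: cF.
near=> p; rewrite /ddist /=.
have hA : `|A s - A p.2| <= d by near: p; exact: fst_near.
have hB : `|B s - B p.2| <= d by near: p; exact: fst_near.
have hC : `|C s - C p.2| <= d by near: p; exact: fst_near.
have hD : `|D s - D p.2| <= d by near: p; exact: fst_near.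
have hQ : `|Q t s - Q p.1 p.2| <= d by near: p; exact: (two_near _ _ _ Q_cont).
have hR : `|Rw t s - Rw p.1 p.2| <= d.
  by near: p; exact: (two_near _ _ _ Rw_cont).
have hRd : `|Rw s s - Rw p.2 p.2| <= d.
  by near: p; exact: (fst_near _ _ _ (diag_cont _ _ _ Rw_cont)).
have hP : `|P (t, s) - P p| <= d by near: p; exact: two_near.
have hPd : `|P (s, s) - P (p.2, p.2)| <= d.
  by near: p; exact: (fst_near _ _ _ (diag_cont _ _ _ cP)).
rewrite /d in hA hB hC hD hQ hR hRd hP hPd; lra.
Unshelve. all: by end_near. Qed.

Lemma coercive_psd s Y : (forall x, 0 <= qform Y x) ->
  coercive delta (Rw s s + (D s)^T *m Y *m D s).
Proof.
by move=> Y0 x; rewrite qformD qform_congr ler_wpDr// ?Rw_coercive.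
Qed.

(* Small enough for [Rw s s + D^T Y D] to stay coercive when [Y] is within
   [radius] of the positive semidefinite [G T]. *)
Definition radius : R := delta / 2 / (n%:R * (m%:R * n%:R * K ^+ 2) + delta).

Let radius_den : 0 < n%:R * (m%:R * n%:R * K ^+ 2) + delta.
Proof. by rewrite ltr_wpDl// !mulr_ge0// sqr_ge0. Qed.

Lemma radius_gt0 : 0 < radius.
Proof. by rewrite /radius !divr_gt0. Qed.

Lemma radius_le1 : radius <= 1.
Proof.
rewrite /radius ler_pdivrMr// mul1r.
have : 0 <= n%:R * (m%:R * n%:R * K ^+ 2) by rewrite !mulr_ge0// sqr_ge0.
have := delta_gt0; lra.
Qed.

Lemma coercive_ball s Y : `|Y - G T| <= radius ->
  coercive (delta / 2) (Rw s s + (D s)^T *m Y *m D s).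
Proof.
move=> Yr x; have -> : Y = G T + (Y - G T) by rewrite addrC subrK.
rewrite qformD qform_congr qformD.
have h1 := Rw_coercive s x; have h2 := G_psd T (D s *m x).
have h3 := qform_norm (Y - G T) (D s *m x).
(* [m n K^2] bounds the squared operator norm of [D s]; [radius] is chosen so that the perturbation
   costs at most half of [delta]. *)
have h4 : n%:R * `|Y - G T| * sqnorm (D s *m x) <= delta / 2 * sqnorm x.
  apply: le_trans (_ : n%:R * radius * (m%:R * n%:R * K ^+ 2 * sqnorm x) <= _).
    rewrite ler_pM ?mulr_ge0 ?sqnorm_ge0 ?sqnorm_mul_le//.
    by rewrite ler_wpM2l.
  rewrite mulrA ler_wpM2r ?sqnorm_ge0//.
  rewrite (_ : n%:R * radius * (m%:R * n%:R * K ^+ 2) =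
    delta / 2 * (n%:R * (m%:R * n%:R * K ^+ 2)) /
      (n%:R * (m%:R * n%:R * K ^+ 2) + delta)); last by rewrite /radius; ring.
  rewrite ler_pdivrMr//.
  by rewrite ler_wpM2l ?lerDl ?divr_ge0 ?(ltW delta_gt0).
move: h3; rewrite ler_norml => /andP[h3 _]; lra.
Qed.

(** Since [radius <= 1], [|G T| + 1] bounds every matrix of the ball. *)
Definition ball_dom := @data_dom R n m (7 * K + 2 * (`|G T| + 1)) (delta / 2).

Lemma datum_ball_dom t s X Y : `|X - G T| <= radius -> `|Y - G T| <= radius ->
  ball_dom (datum t s X Y).
Proof.
move=> hX hY; have bnd Z : `|Z - G T| <= radius -> `|Z| <= `|G T| + 1.
  move=> hZ; rewrite -[Z](subrK (G T)) addrC.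
  apply: le_trans (ler_normD _ _) _; rewrite lerD2l.
  exact: le_trans hZ radius_le1.
by apply: datum_dom; [exact: bnd|exact: bnd|exact: coercive_ball].
Qed.

Lemma drhs_sym (z : @data R n m) :
  (dP z)^T = dP z -> (dQ z)^T = dQ z -> (dR z)^T = dR z ->
  (drhs z)^T = drhs z.
Proof.
move=> hP hQ hR; rewrite /drhs; move: (dAT z) (dCT z) (dTheta z) => X Y W.
rewrite !linearD/= !trmx_mul !trmxK hP hQ hR !mulmxA.
by congr (_ + _ + _ + _); exact: addrC.
Qed.

(** Positivity of both solutions gives coercivity with the full [delta], and continuity on the
    compact triangle gives a common norm bound, so both live in one domain where [drhs] is
    Lipschitz. *)
Lemma riccati_unique kappa P P' : 0 < kappa -> kappa <= T ->
  riccati_solution A C B D G Q Rw T kappa P ->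
  riccati_solution A C B D G Q Rw T kappa P' ->
  forall t s, T - kappa <= t -> t <= s -> s <= T -> P' t s = P t s.
Proof.
move=> k0 kT [Pc Ppsd Peq PT] [P'c P'psd P'eq P'T].
have aT : T - kappa <= T by rewrite gerBl ltW.
have [M M0 PM] := within_compact_bounded Pc (compact_triangle aT).
have [M' M'0 PM'] := within_compact_bounded P'c (compact_triangle aT).
pose N := M + M'.
have d20 : 0 < delta by [].
have [L [L0 _ Llip]] := @bdd_lip_drhs R n m (7 * K + 2 * N) delta d20.
have dom (X : R -> R -> 'M[R]_n) t s : (X = P \/ X = P') ->
    T - kappa <= t -> t <= s -> s <= T ->
    `|X t s| <= N /\ data_dom (7 * K + 2 * N) delta (datum t s (X t s) (X s s)).
  move=> XE at_ ts sT; have as_ := le_trans at_ ts.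
  have bnd u v : T - kappa <= u -> u <= v -> v <= T -> `|X u v| <= N.
    move=> au uv vT; have tri : triangle (T - kappa) T (u, v) by [].
    case: XE => ->; rewrite /N.
      by apply: le_trans (PM _ tri) _; rewrite lerDl.
    by apply: le_trans (PM' _ tri) _; rewrite lerDr.
  split; first exact: bnd.
  apply: datum_dom; [exact: bnd|exact: bnd|apply: coercive_psd].
  by case: XE => ->; [have [] := Ppsd s s as_ (lexx s) sT|
    have [] := P'psd s s as_ (lexx s) sT].
have eqn (X : R -> R -> 'M[R]_n) t s (dX : 'M[R]_n) :
    dX + X t s *m A_Theta A C B D Rw X s
      + (A_Theta A C B D Rw X s)^T *m X t s
      + (C_Theta C B D Rw X s)^T *m X t s *m C_Theta C B D Rw X s
      + Q t s + (Theta C B D Rw X s)^T *m Rw t s *m Theta C B D Rw X s = 0 ->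
    dX = - drhs (datum t s (X t s) (X s s)).
  by rewrite -!addrA => /eqP; rewrite addr_eq0 => /eqP ->; rewrite /drhs !addrA.
move=> t s at_ ts sT; apply/eqP; rewrite -subr_eq0; apply/eqP.
pose dE t s := - drhs (datum t s (P' t s) (P' s s)) - - drhs (datum t s (P t s) (P s s)).
apply: (@triangle_gronwall R n n (fun t s => P' t s - P t s) dE
  (T - kappa) T L (N + N)) => //.
- by rewrite !addr_ge0.
- move=> {at_ ts sT s t} t s at_ ts sT.
  have [dP1 [hP1 /eqn E1]] := Peq t s at_ ts sT.
  have [dP2 [hP2 /eqn E2]] := P'eq t s at_ ts sT.
  have [b1 d1] := dom P t s (or_introl erefl) at_ ts sT.
  have [b2 d2] := dom P' t s (or_intror erefl) at_ ts sT.
  split.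
  + by apply: is_derive_inB; rewrite -?E1 -?E2.
  + rewrite /dE opprK addrC distrC; apply: le_trans (Llip _ _ d2 d1) _.
    by rewrite ddist_datum.
  + by apply: le_trans (ler_normB _ _) _; rewrite lerD.
- by move=> u au uT; rewrite PT// P'T// subrr.
Qed.


(** * The Picard operator and its fixed point *)

Definition rhs (P : R * R -> 'M[R]_n) (p : R * R) : 'M[R]_n :=
  drhs (datum p.1 p.2 (P p) (P (p.2, p.2))).

(** The operator acts on functions on the whole plane, including [s < t], which avoids continuity
    relative to the triangle. Here [t] is clamped; [s] is clamped inside [backward_integral]. *)
Definition picard (a : R) (P : R * R -> 'M[R]_n) (p : R * R) : 'M[R]_n :=
  G (clamp a T p.1)
  + backward_integral a T (fun r => rhs P (clamp a T p.1, r)) p.2.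

Definition admissible : set (R * R -> 'M[R]_n) :=
  [set P : R * R -> 'M[R]_n | [/\ continuous P, forall p, `|P p - G T| <= radius &
    forall p, (P p)^T = P p]].

Lemma datum_continuous p q (f : data -> 'M[R]_(p, q)) P : admissible P ->
  bdd_lip ddist ball_dom f ->
  continuous (fun r : R * R => f (datum r.1 r.2 (P r) (P (r.2, r.2)))).
Proof.
move=> [Pc Pr _] fl.
apply: (bdd_lip_continuous (z := fun r : R * R =>
  datum r.1 r.2 (P r) (P (r.2, r.2))) fl) => [r|[t s] e e0].
  exact: datum_ball_dom.
exact: near_ddist_datum.
Qed.

Lemma rhs_continuous P : admissible P -> continuous (rhs P).
Proof.
move=> aP; apply: (datum_continuous aP); apply: bdd_lip_drhs.
by rewrite divr_gt0.
Qed.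

Lemma rhs_clamp_continuous a P : admissible P ->
  continuous (fun p : R * R => rhs P (clamp a T p.1, p.2)).
Proof.
move=> aP p.
apply: (@continuous_comp _ _ _ (fun p : R * R => (clamp a T p.1, p.2)) (rhs P)).
  have c1 : clamp a T q.1 @[q --> p] --> clamp a T p.1.
    apply: (@continuous_comp _ _ _ fst (clamp a T) p); first exact: cvg_fst.
    exact: continuous_clamp.
  have c2 : q.2 @[q --> p] --> p.2 by exact: cvg_snd.
  exact: (cvg_pair c1 c2).
exact: rhs_continuous.
Qed.

(** Half of [radius] is spent on the oscillation of [G], half on the integral. *)
Lemma picard_admissible a L P : a <= T -> 0 <= L ->
  (forall z, ball_dom z -> `|drhs z| <= L) ->
  (forall t, a <= t <= T -> `|G t - G T| <= radius / 2) ->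
  L * (T - a) <= radius / 2 ->
  admissible P -> admissible (picard a P).
Proof.
move=> aT L0 hL hG hk aP; have [Pc Pr Ps] := aP.
have cr := rhs_clamp_continuous aP (a := a).
have crt t : continuous (fun r => rhs P (clamp a T t, r)).
  by move=> r; exact: (continuous_section (t := t) cr).
split.
- move=> p; apply: cvgD.
    apply: (@continuous_comp _ _ _ (fun q : R * R => clamp a T q.1) G p);
      last exact: G_cont.
    apply: (@continuous_comp _ _ _ fst (clamp a T) p); first exact: cvg_fst.
    exact: continuous_clamp.
  exact: (backward_integral_continuous2 cr aT).
- move=> [t s]; rewrite /picard addrAC [leRHS]splitr.
  apply: le_trans (ler_normD _ _) _; apply: lerD; first exact/hG/clamp_itv.
  apply: le_trans hk; apply: backward_integral_norm => // r _.
  by apply: hL; exact: datum_ball_dom.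
- move=> [t s]; rewrite /picard linearD/= G_sym; congr (_ + _).
  apply/matrixP => i j; rewrite !mxE /=.
  have rs r : rhs P (clamp a T t, r) j i = rhs P (clamp a T t, r) i j.
    have {1}<- : (rhs P (clamp a T t, r))^T = rhs P (clamp a T t, r).
      by apply: drhs_sym; [exact: Ps|exact: Q_sym|exact: Rw_sym].
    by rewrite mxE.
  by congr (_ - _); apply: eq_Rintegral => r _; rewrite rs.
Qed.

(** The terminal terms cancel. The datum contains the unknown at [(t, s)] and on the diagonal, so
    the integrals differ by at most [2 L d (T - a)], whence the factor 4. *)
Lemma picard_contraction a L P P' d : a <= T -> 0 <= L -> 0 <= d ->
  (forall z z', ball_dom z -> ball_dom z' ->
     `|drhs z - drhs z'| <= L * ddist z z') ->
  4 * L * (T - a) <= 1 ->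
  admissible P -> admissible P' -> (forall p, `|P p - P' p| <= d) ->
  forall p, `|picard a P p - picard a P' p| <= d / 2.
Proof.
move=> aT L0 d0 hL hk aP aP' PP' [t s].
have crt X : admissible X -> continuous (fun r => rhs X (clamp a T t, r)).
  move=> aX r; exact: (continuous_section (t := t) (rhs_clamp_continuous aX (a := a))).
rewrite /picard opprD addrACA subrr add0r /=.
apply: le_trans (_ : L * (d + d) * (T - a) <= _).
  apply: backward_integral_dist => //; [exact: crt|exact: crt| |].
    by rewrite mulr_ge0// addr_ge0.
  move=> r _; have [_ Pr _] := aP; have [_ Pr' _] := aP'.
  apply: le_trans (hL _ _ _ _) _; try exact: datum_ball_dom.
  by rewrite ler_wpM2l// ddist_datum lerD.
have := ler_wpM2l d0 hk; lra.
Qed.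

Lemma admissible_closed P :
  (forall e, 0 < e -> exists2 P', admissible P' & forall p, `|P p - P' p| <= e) ->
  admissible P.
Proof.
move=> PP; split.
- move=> p; apply/cvgrPdist_le => e e0; have e30 : 0 < e / 3 by rewrite divr_gt0.
  have [P' [P'c _ _] PP'] := PP _ e30.
  have /cvgrPdist_le/(_ _ e30) := P'c p; apply: filterS => q hq.
  have -> : P p - P q = (P p - P' p) + (P' p - P' q) - (P q - P' q).
    by apply/matrixP => i j; rewrite !mxE; ring.
  apply: le_trans (ler_normB _ _) _; have := ler_normD (P p - P' p) (P' p - P' q).
  have := PP' p; have := PP' q; lra.
- move=> p; apply/ler_addgt0Pr => e e0; have [P' [_ P'r _] PP'] := PP _ e0.
  have -> : P p - G T = (P' p - G T) + (P p - P' p).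
    by apply/matrixP => i j; rewrite !mxE; ring.
  by apply: le_trans (ler_normD _ _) _; rewrite lerD.
- move=> p; apply/eqP; rewrite -subr_eq0 -normr_eq0 eq_le normr_ge0 andbT.
  apply/ler_addgt0Pr => e e0; rewrite add0r; have e20 : 0 < e / 2 by rewrite divr_gt0.
  have [P' [_ _ P's] PP'] := PP _ e20.
  have -> : (P p)^T - P p = (P p - P' p)^T - (P p - P' p).
    rewrite linearB/= P's; by apply/matrixP => i j; rewrite !mxE; ring.
  apply: le_trans (ler_normB _ _) _; rewrite mx_norm_tr [leRHS]splitr.
  by rewrite lerD.
Qed.

Lemma admissible_cst : admissible (fun=> G T).
Proof.
split=> [|p|p]; [exact: cst_continuous| |exact: G_sym].
by rewrite subrr normr0 ltW// radius_gt0.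
Qed.

Lemma picard_fixpoint_solution kappa L P : 0 < kappa -> kappa <= T -> 0 <= L ->
  (forall z, ball_dom z -> `|dAT z| <= L /\ `|dCT z| <= L) ->
  (forall t s x, 0 <= t -> t <= s -> s <= T -> 0 <= qform (Q t s) x) ->
  (forall t s x, 0 <= t -> t <= s -> s <= T -> 0 <= qform (Rw t s) x) ->
  admissible P -> (forall p, picard (T - kappa) P p = P p) ->
  riccati_solution A C B D G Q Rw T kappa (fun t s => P (t, s)).
Proof.
move=> k0 kT L0 hL Q0 R0 aP Pfix; have [Pc Pr Ps] := aP.
set a := T - kappa in Pfix *; have aT : a <= T by rewrite gerBl ltW.
have a0 : 0 <= a by rewrite subr_ge0.
have PT t : a <= t -> t <= T -> P (t, T) = G t.
  move=> at_ tT; rewrite -Pfix /picard /= clamp_id// backward_integral_right//.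
  by rewrite addr0.
have dP t s : a <= t -> t <= s -> s <= T ->
    is_derive_in `[t, T] (fun s => P (t, s)) s (- rhs P (t, s)).
  move=> at_ ts sT; have as_ := le_trans at_ ts; have tT := le_trans ts sT.
  have cr : continuous (fun r => rhs P (t, r)).
    by move=> r; exact: (continuous_section (t := t) (rhs_continuous aP)).
  have asT : a <= s <= T by rewrite as_.
  have /is_derive_inP dI := is_derive_backward_integral cr asT.
  apply/is_derive_inP => e e0; apply: filterS (dI e e0) => y hy ytT.
  have PE r : P (t, r) = G t + backward_integral a T (fun r => rhs P (t, r)) r.
    by rewrite -Pfix /picard /= clamp_id.
  rewrite (PE y) (PE s) opprD addrACA subrr add0r; apply: hy.
  by move: ytT; rewrite /= !in_itv/= => /andP[ty ->]; rewrite (le_trans at_).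
split=> //.
- apply: continuous_subspaceT; rewrite (_ : (fun p => _) = P)//.
  by apply/funext => -[].
- move=> t s at_ ts sT; split; first by apply/symmetricmxP; exact: Ps.
  have tsT : t <= s <= T by rewrite ts.
  have dom r u : ball_dom (datum r u (P (r, u)) (P (u, u))).
    exact: datum_ball_dom.
  pose z r := datum t r (P (t, r)) (P (r, r)).
  apply: (@lyapunov_psd R n (fun s => P (t, s)) (fun r => dAT (z r))
    (fun r => dCT (z r))
    (fun r => Q t r + (dTheta (z r))^T *m Rw t r *m dTheta (z r)) t T L) => //.
  + move=> r /andP[tr rT]; rewrite addrA; exact: dP.
  + move=> r /andP[tr rT]; have [h1 h2] := hL _ (dom t r).
    split=> // x; rewrite qformD qform_congr.
    have t0 := le_trans a0 at_; by rewrite addr_ge0 ?Q0 ?R0.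
  + move=> x; rewrite PT//; exact: le_trans sT.
- move=> t s at_ ts sT; exists (- rhs P (t, s)); split; first exact: dP.
  rewrite -!addrA; apply/eqP; rewrite addr_eq0; apply/eqP; congr (- _).
  by rewrite /rhs /drhs !addrA.
Qed.

Lemma riccati_local_wellposed : 0 < T ->
  (forall t s x, 0 <= t -> t <= s -> s <= T -> 0 <= qform (Q t s) x) ->
  (forall t s x, 0 <= t -> t <= s -> s <= T -> 0 <= qform (Rw t s) x) ->
  exists kappa : R, [/\ 0 < kappa, kappa <= T &
    exists P : R -> R -> 'M[R]_n,
      [/\ riccati_solution A C B D G Q Rw T kappa P,
          (forall P' : R -> R -> 'M[R]_n,
             riccati_solution A C B D G Q Rw T kappa P' ->
             forall t s, T - kappa <= t -> t <= s -> s <= T -> P' t s = P t s)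
        & continuous (Theta C B D Rw P)]].
Proof.
move=> T0 Q0 R0.
have d20 : 0 < delta / 2 by rewrite divr_gt0.
have [L1 [L10 L1b L1l]] := @bdd_lip_drhs R n m (7 * K + 2 * (`|G T| + 1)) _ d20.
have [L2 [L20 L2b _]] := @bdd_lip_dAT R n m (7 * K + 2 * (`|G T| + 1)) _ d20.
have [L3 [L30 L3b _]] := @bdd_lip_dCT R n m (7 * K + 2 * (`|G T| + 1)) _ d20.
have r20 : 0 < radius / 2 by rewrite divr_gt0// radius_gt0.
have /cvgrPdist_le/(_ _ r20)/nbhs_ballP[k1 /= k10 Gk1] := @G_cont T.
have den0 : 0 < 4 * L1 + 1 by lra.
(* [k1 / 2] stays inside the open ball where [G] is within [radius / 2] of [G T]. The last term
   gives [4 L1 kappa <= radius / 2 <= 1], which covers both stability of the ball and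
   contraction. *)
pose kappa := Num.min (Num.min T (k1 / 2)) (radius / 2 / (4 * L1 + 1)).
have kT : kappa <= T by rewrite /kappa !ge_min lexx.
have kk1 : kappa <= k1 / 2 by rewrite /kappa !ge_min lexx orbT.
have kr : kappa <= radius / 2 / (4 * L1 + 1) by rewrite /kappa ge_min lexx orbT.
have k0 : 0 < kappa by rewrite /kappa !lt_min T0 !divr_gt0 ?radius_gt0.
have kr' : 4 * L1 * kappa <= radius / 2.
  move: kr; rewrite ler_pdivlMr// => kr; nra.
pose a := T - kappa.
have aT : a <= T by rewrite gerBl ltW.
have Ta : T - a = kappa by rewrite /a opprB addrC subrK.
have hG t : a <= t <= T -> `|G t - G T| <= radius / 2.
  move=> /andP[at_ tT]; rewrite distrC; apply: Gk1.
  rewrite -ball_normE /= ger0_norm ?subr_ge0//.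
  by rewrite /a in at_; lra.
have LTa : L1 * (T - a) <= radius / 2 by rewrite Ta; nra.
have hk : 4 * L1 * (T - a) <= 1 by rewrite Ta; have := radius_le1; lra.
have [P aP Pfix] : exists2 P, admissible P & forall p, picard a P p = P p.
  apply: (@contraction_fixpoint R (R * R)%type n n admissible (picard a) (fun=> G T)
    (radius + radius)).
  - exact: admissible_cst.
  - by move=> P; exact: (picard_admissible aT L10 L1b hG LTa).
  - exact: admissible_closed.
  - by rewrite addr_ge0 ?ltW ?radius_gt0.
  - move=> p; have [_ h _] := picard_admissible aT L10 L1b hG LTa admissible_cst.
    by apply: le_trans (h p) _; rewrite lerDl ltW// radius_gt0.
  - by move=> P P' d d0 aP aP'; exact: (picard_contraction aT L10 d0 L1l hk aP aP').
exists kappa; split=> //; exists (fun t s => P (t, s)).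
have solP : riccati_solution A C B D G Q Rw T kappa (fun t s => P (t, s)).
  apply: (@picard_fixpoint_solution kappa (L2 + L3)) => //.
    by rewrite addr_ge0.
  move=> z zd; split; first by apply: le_trans (L2b z zd) _; rewrite lerDl.
  by apply: le_trans (L3b z zd) _; rewrite lerDr.
split=> // [P' solP'|s]; first exact: (riccati_unique k0 kT solP solP').
have cT := datum_continuous aP (@bdd_lip_dTheta R n m _ _ d20).
apply: (@continuous_comp _ _ _ (fun s => (s, s))
  (fun r : R * R => dTheta (datum r.1 r.2 (P r) (P (r.2, r.2)))) s).
  exact: (cvg_pair (@cvg_id _ (nbhs s)) (@cvg_id _ (nbhs s))).
exact: cT.
Qed.

End Riccati.

(** Used in both directions: the constructed solution passes to the original coefficients, and a
    competing solution passes to the clamped ones before uniqueness is applied. *)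
Lemma riccati_solution_ext (R : realType) (n m : nat)
    (A A' C C' : R -> 'M[R]_n) (B B' D D' : R -> 'M[R]_(n, m))
    (G G' : R -> 'M[R]_n) (Q Q' : R -> R -> 'M[R]_n)
    (Rw Rw' : R -> R -> 'M[R]_m) (T kappa : R) P :
  kappa <= T ->
  (forall s, 0 <= s -> s <= T ->
     [/\ A s = A' s, B s = B' s, C s = C' s, D s = D' s & G s = G' s]) ->
  (forall t s, 0 <= t -> t <= s -> s <= T ->
     Q t s = Q' t s /\ Rw t s = Rw' t s) ->
  riccati_solution A C B D G Q Rw T kappa P ->
  riccati_solution A' C' B' D' G' Q' Rw' T kappa P.
Proof.
move=> kT eq1 eq2 [Pc Ppsd Peq PT].
have a0 : 0 <= T - kappa by rewrite subr_ge0.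
split=> // [t s at_ ts sT|t at_ tT]; last first.
  by have [_ _ _ _ <-] := eq1 t (le_trans a0 at_) tT; exact: PT.
have t0 := le_trans a0 at_; have s0 := le_trans t0 ts.
have [dP [hdP E]] := Peq t s at_ ts sT; exists dP; split=> //.
have [eA eB eC eD _] := eq1 s s0 sT.
have [eQ eR] := eq2 t s t0 ts sT; have [_ eRs] := eq2 s s s0 (lexx s) sT.
by move: E; rewrite /A_Theta /C_Theta /Theta eA eB eC eD eQ eR eRs.
Qed.

Theorem theorem4p1 (R : realType) (n m : nat) (T : R)
    (A C : R -> 'M[R]_n) (B D : R -> 'M[R]_(n, m))
    (G : R -> 'M[R]_n) (Q : R -> R -> 'M[R]_n) (Rw : R -> R -> 'M[R]_m)
    (T_gt0 : 0 < T)
    (A_cont : {within `[0, T], continuous A})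
    (C_cont : {within `[0, T], continuous C})
    (B_cont : {within `[0, T], continuous B})
    (D_cont : {within `[0, T], continuous D})
    (G_cont : {within `[0, T], continuous G})
    (G_sym : forall t, t \in `[0, T] -> G t \is symmetricmx)
    (Q_cont : continuous2_in (square T) Q)
    (Q_sym : forall t s, t \in `[0, T] -> s \in `[0, T] -> Q t s \is symmetricmx)
    (Rw_cont : continuous2_in (square T) Rw)
    (Rw_sym : forall t s, t \in `[0, T] -> s \in `[0, T] -> Rw t s \is symmetricmx)
    (hyp_i : exists delta : R, 0 < delta /\
       forall t s, 0 <= t -> t <= s -> s <= T ->
         [/\ loewner_le 0 (Q t s), loewner_le delta%:M (Rw t s)
           & loewner_le 0 (G t)])
    (hyp_ii : exists (Qhat : 'M[R]_n) (Rhat : 'M[R]_m) (Ghat : 'M[R]_n),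
       [/\ pdmx Qhat, pdmx Rhat, pdmx Ghat &
        forall t r s, 0 <= t -> t <= r -> r <= s -> s <= T ->
          [/\ loewner_le (Q t s) (Q r s) /\ loewner_le (Q r s) Qhat,
              loewner_le (Rw t s) (Rw r s) /\ loewner_le (Rw r s) Rhat
            & loewner_le (G t) (G r) /\ loewner_le (G r) Ghat]])
    (hyp_iii : [/\ C1_on 0 T G, C1_fst_on_triangle T Q
                 & C1_fst_on_triangle T Rw]) :
  exists kappa : R, [/\ 0 < kappa, kappa <= T &
    exists P : R -> R -> 'M[R]_n,
      [/\ riccati_solution A C B D G Q Rw T kappa P,
          (forall P' : R -> R -> 'M[R]_n,
             riccati_solution A C B D G Q Rw T kappa P' ->
             forall t s, T - kappa <= t -> t <= s -> s <= T -> P' t s = P t s)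
        & {within `[T - kappa, T], continuous (Theta C B D Rw P)}]].
Proof.
have [delta [delta0 hi]] := hyp_i; have T0 := ltW T_gt0.
have loew p (M N : 'M[R]_p) : loewner_le M N -> forall x, qform M x <= qform N x.
  by move=> [_ h] x; have := h x; rewrite -/(qform _ x) qformB subr_ge0.
have qf0 p x : qform (0 : 'M[R]_p) x = 0 by rewrite /qform mulmx0 mul0mx mxE.
have Q_psd t s x : 0 <= t -> t <= s -> s <= T -> 0 <= qform (Q t s) x.
  by move=> t0 ts sT; have [/loew/(_ x)] := hi t s t0 ts sT; rewrite qf0.
have Rw_coer t s : 0 <= t -> t <= s -> s <= T -> coercive delta (Rw t s).
  move=> t0 ts sT x; have [_ /loew/(_ x) + _] := hi t s t0 ts sT.
  by rewrite qform_scalar.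
have Rw_psd t s x : 0 <= t -> t <= s -> s <= T -> 0 <= qform (Rw t s) x.
  move=> t0 ts sT; apply: le_trans (Rw_coer t s t0 ts sT x).
  by rewrite mulr_ge0 ?sqnorm_ge0// ltW.
have cseg : compact (`[0, T] : set R) by exact: segment_compact.
have csq : compact (square T) by exact: compact_setX.
have [KA KA0 hA] := within_compact_bounded A_cont cseg.
have [KB KB0 hB] := within_compact_bounded B_cont cseg.
have [KC KC0 hC] := within_compact_bounded C_cont cseg.
have [KD KD0 hD] := within_compact_bounded D_cont cseg.
have [KQ KQ0 hQ] := within_compact_bounded Q_cont csq.
have [KR KR0 hR] := within_compact_bounded Rw_cont csq.
pose cl := clamp 0 T.
have clI s : cl s \in `[0, T] by rewrite in_itv/=; exact: clamp_itv.
have cl0 s : 0 <= cl s by have := clamp_itv s T0 => /andP[].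
have clT s : cl s <= T by have := clamp_itv s T0 => /andP[].
have clE s : 0 <= s -> s <= T -> cl s = s by exact: clamp_id.
have cont1 p q (F : R -> 'M[R]_(p, q)) :
    {within `[0, T], continuous F} -> continuous (F \o cl).
  move=> cF; apply: continuous_comp_within cF _ _; last exact: clI.
  exact: continuous_clamp.
(* [Q] and [Rw] are continuous on the full square, so the two times can be clamped independently. *)
have cont2 p q (F : R -> R -> 'M[R]_(p, q)) : continuous2_in (square T) F ->
    continuous (fun r : R * R => F (cl r.1) (cl r.2)).
  move=> cF.
  apply: (continuous_comp_within (c := fun r : R * R => (cl r.1, cl r.2)) cF).
    move=> r.
    have c1 : cl q.1 @[q --> r] --> cl r.1.
      apply: (@continuous_comp _ _ _ fst cl r); first exact: cvg_fst.
      exact: continuous_clamp.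
    have c2 : cl q.2 @[q --> r] --> cl r.2.
      apply: (@continuous_comp _ _ _ snd cl r); first exact: cvg_snd.
      exact: continuous_clamp.
    exact: (cvg_pair c1 c2).
  by move=> r; split; exact: clI.
pose K := KA + KB + KC + KD + KQ + KR.
have K0 : 0 <= K by rewrite /K !addr_ge0.
have := @riccati_local_wellposed R n m (A \o cl) (C \o cl) (B \o cl) (D \o cl)
  (G \o cl) (fun t s => Q (cl t) (cl s)) (fun t s => Rw (cl t) (cl s)) T K delta.
case; try by [].
- exact: cont1.
- exact: cont1.
- exact: cont1.
- exact: cont1.
- exact: cont1.
- exact: cont2.
- exact: cont2.
- by move=> s; apply: le_trans (hA _ (clI s)) _; rewrite /K; lra.
- by move=> s; apply: le_trans (hB _ (clI s)) _; rewrite /K; lra.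
- by move=> s; apply: le_trans (hC _ (clI s)) _; rewrite /K; lra.
- by move=> s; apply: le_trans (hD _ (clI s)) _; rewrite /K; lra.
- move=> t s; apply: le_trans (hQ (cl t, cl s) _) _; last by rewrite /K; lra.
  by split; exact: clI.
- move=> t s; apply: le_trans (hR (cl t, cl s) _) _; last by rewrite /K; lra.
  by split; exact: clI.
- by move=> t; exact/symmetricmxP/G_sym.
- by move=> t s; exact/symmetricmxP/Q_sym.
- by move=> t s; exact/symmetricmxP/Rw_sym.
(* On the diagonal the clamped pair is still diagonal, hence in the triangle where the coercivity
   hypothesis applies. *)
- by move=> s; exact: Rw_coer.
- by move=> t x; have [_ _ /loew/(_ x)] := hi _ _ (cl0 t) (lexx _) (clT t); rewrite qf0.
- move=> t s x t0 ts sT; rewrite !clE ?(le_trans t0 ts) ?(le_trans ts sT)//.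
  exact: Q_psd.
- move=> t s x t0 ts sT; rewrite !clE ?(le_trans t0 ts) ?(le_trans ts sT)//.
  exact: Rw_psd.
move=> kappa [k0 kT [P [solP uniP cTh]]].
exists kappa; split=> //; exists P.
have e1 s : 0 <= s -> s <= T -> [/\ A (cl s) = A s, B (cl s) = B s,
    C (cl s) = C s, D (cl s) = D s & G (cl s) = G s].
  by move=> s0 sT; rewrite clE.
have e2 t s : 0 <= t -> t <= s -> s <= T ->
    Q (cl t) (cl s) = Q t s /\ Rw (cl t) (cl s) = Rw t s.
  by move=> t0 ts sT; rewrite !clE ?(le_trans t0 ts) ?(le_trans ts sT).
split.
- exact: riccati_solution_ext kT e1 e2 solP.
- move=> P' solP'; apply: uniP; apply: riccati_solution_ext kT _ _ solP'.
    by move=> s s0 sT; rewrite /= !clE.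
  by move=> t s t0 ts sT; have [-> ->] := e2 t s t0 ts sT.
- apply/subspace_continuousP => s; rewrite /= in_itv/= => /andP[as_ sT].
  have ThE r : r \in `[T - kappa, T] -> Theta (C \o cl) (B \o cl) (D \o cl)
      (fun t s => Rw (cl t) (cl s)) P r = Theta C B D Rw P r.
    rewrite in_itv/= => /andP[ar rT].
    have r0 : 0 <= r by apply: le_trans ar; rewrite subr_ge0.
    by rewrite /Theta /= !clE.
  apply/cvgrPdist_le => e e0; have /cvgrPdist_le/(_ e e0) h := cTh s.
  suff : \forall r \near s, r \in `[T - kappa, T] ->
    `|Theta C B D Rw P s - Theta C B D Rw P r| <= e by [].
  by apply: filterS h => r hr rI; rewrite -!ThE ?in_itv/= ?as_.
Qed.
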